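(* For each $n$ let $X_1(t),\dots,X_n(t)$ be Dyson Brownian motion with $n$ particles started from $0$, and let $\mu_{n,t}=\frac1n\sum_{j=1}^n\delta_{X_j(t)}$ be its empirical measure at time $t$. Then, at time $t=\frac1n$, the random measures $\mu_{n,1/n}$ converge weakly in expectation as $n\to\infty$ to the semicircle law with density $\rho_{\mathrm{semicircle}}(x)=\frac{1}{2\pi}\sqrt{4-x^2}$ on $[-2,2]$; that is, for every bounded continuous $f:\mathbb{R}\to\mathbb{R}$, $$\lim_{n\to\infty}\mathbb{E}\Big[\int_{\mathbb{R}}f(x)\,\mu_{n,1/n}(dx)\Big]=\lim_{n\to\infty}\frac1n\sum_{j=1}^n\mathbb{E}\Big[f\big(X_j(\tfrac1n)\big)\Big]=\int_{-2}^{2}f(x)\,\frac{1}{2\pi}\sqrt{4-x^2}\,dx.$$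
   Context: Dyson Brownian motion with $n$ particles started from $0$ is the process of ordered eigenvalues $X_1(t)\ge\dots\ge X_n(t)$ of the $n\times n$ Hermitian Brownian motion $H(t)$: $H(t)$ is Hermitian with $H(0)=0$, its diagonal entries are standard real Brownian motions, its entries above the diagonal are $\frac{1}{\sqrt2}(B_{j\ell}(t)+\imath\beta_{j\ell}(t))$, $j<\ell$, and all the real Brownian motions $B_{jj},B_{j\ell},\beta_{j\ell}$ ($j<\ell$) are standard and independent. Equivalently it is $n$ Brownian motions started from $0$ and conditioned never to intersect. *)

(* Defs.v *)
From HB Require Import structures.
From mathcomp Require Import all_boot all_order all_algebra.
From mathcomp Require Import complex.
From mathcomp Require Import all_classical all_reals all_analysis.

Set Implicit Arguments.
Unset Strict Implicit.
Unset Printing Implicit Defensive.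

Import Order.TTheory GRing.Theory Num.Theory.
Import numFieldNormedType.Exports.

Local Open Scope classical_set_scope.
Local Open Scope ring_scope.

Section Independence.
Context {d : measure_display} {T : measurableType d} {R : realType}.
Variable P : probability T R.

Definition mutually_independent (I : finType) (D : {set I})
    (F : I -> set (set T)) : Prop :=
  forall (J : {set I}) (A : I -> set T), J \subset D ->
    (forall i, i \in J -> F i (A i)) ->
    P (\bigcap_(i in [set` J]) A i) = (\prod_(i in J) P (A i))%E.

Definition sigma_rv (Y : T -> R) : set (set T) :=
  preimage_set_system setT Y measurable.

Definition sigma_process (Y : R -> T -> R) : set (set T) :=
  <<s \bigcup_(t in [set t | 0 <= t]) sigma_rv (Y t) >>.

End Independence.

Section BrownianMotion.
Context {d : measure_display} {T : measurableType d} {R : realType}.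
Variable P : probability T R.

(* A process is indexed by all of [R], but only its values at times [0 <= t]
   are ever constrained or used.  The increments are required to be Gaussian
   for [s < t] only: [normal_prob m 0] is not the Dirac mass at [m] but the
   uniform law on [0, 1]. *)
Definition brownian_motion (B : R -> {RV P >-> R}) : Prop :=
  [/\ {ae P, forall w, B 0 w = 0},
      {ae P, forall w,
        {within [set t : R | 0 <= t], continuous (fun t => B t w)}},
      (forall s t : R, 0 <= s -> s < t -> forall A : set R, measurable A ->
        P ((fun w => B t w - B s w) @^-1` A)
          = normal_prob 0 (Num.sqrt (t - s)) A) &
      (forall (k : nat) (t : nat -> R), 0 <= t 0%N ->
        {homo t : i j / (i <= j)%N >-> i <= j} ->
        mutually_independent P [set: 'I_k]%SET
          (fun i => sigma_rv (fun w => B (t i.+1) w - B (t i) w)))].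

End BrownianMotion.

Section Dyson.
Context {d : measure_display} {T : measurableType d} {R : realType}.
Variable P : probability T R.
Variable n : nat.

(* The driving processes are [B j l] for [j <= l] (index [(false, (j, l))])
   and [beta j l] for [j < l] (index [(true, (j, l))]); the values of [B] and
   [beta] at other indices are irrelevant. *)
Definition driving_index : {set bool * ('I_n * 'I_n)} :=
  [set i : bool * ('I_n * 'I_n) | if i.1 then (i.2.1 < i.2.2)%N else (i.2.1 <= i.2.2)%N]%SET.

Definition driving_process (B beta : 'I_n -> 'I_n -> R -> {RV P >-> R})
    (i : bool * ('I_n * 'I_n)) : R -> {RV P >-> R} :=
  if i.1 then beta i.2.1 i.2.2 else B i.2.1 i.2.2.

Definition independent_brownian_motions
    (B beta : 'I_n -> 'I_n -> R -> {RV P >-> R}) : Prop :=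
  (forall i, i \in driving_index -> brownian_motion (driving_process B beta i))
  /\ mutually_independent P driving_index
       (fun i => sigma_process (fun t => driving_process B beta i t)).

Definition hermitian_bm (B beta : 'I_n -> 'I_n -> R -> {RV P >-> R})
    (t : R) (w : T) : 'M[R[i]]_n :=
  let z j l := (((Num.sqrt 2)^-1)%:C * (B j l t w +i* beta j l t w))%C in
  \matrix_(j, l) if j == l then ((B j j t w)%:C)%C
                 else if (j < l)%N then z j l else ((z l j)^*)%C.

Definition ordered_eigenvalues (A : 'M[R[i]]_n) (x : 'I_n -> R) : Prop :=
  (forall i j : 'I_n, (i <= j)%N -> x j <= x i) /\
  char_poly A = \prod_(j < n) ('X - ((x j)%:C%C)%:P).

Definition dyson_brownian_motion (X : 'I_n -> R -> T -> R) : Prop :=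
  exists B beta : 'I_n -> 'I_n -> R -> {RV P >-> R},
    independent_brownian_motions B beta /\
    forall t w, 0 <= t ->
      ordered_eigenvalues (hermitian_bm B beta t w) (fun j => X j t w).

End Dyson.

Section EmpiricalMeasure.
Context {R : realType}.
Variables (n : nat) (x : 'I_n -> R).
Local Open Scope ereal_scope.

Definition empirical_measure (A : set R) : \bar R :=
  (n%:R^-1)%:E * \sum_(j < n) \d_(x j) A.

Let empirical_measure0 : empirical_measure set0 = 0.
Proof. by rewrite /empirical_measure big1 ?mule0// => j _; rewrite measure0. Qed.

Let empirical_measure_ge0 A : 0 <= empirical_measure A.
Proof. by rewrite mule_ge0 ?lee_fin ?invr_ge0// sume_ge0. Qed.

Let empirical_measure_sigma_additive : semi_sigma_additive empirical_measure.
Proof.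
pose m (k : nat) : {measure set R -> \bar R} :=
  if insub k is Some j then \d_(x j) else mzero.
have n0 : (0 <= n%:R^-1 :> R)%R by rewrite invr_ge0.
have -> : empirical_measure = mscale (NngNum n0) (msum m n).
  apply/funext => A; rewrite /empirical_measure /mscale /msum /=.
  by congr (_ * _); apply: eq_bigr => j _; rewrite /m valK.
exact: measure_semi_sigma_additive.
Qed.

HB.instance Definition _ := isMeasure.Build _ _ _ empirical_measure
  empirical_measure0 empirical_measure_ge0 empirical_measure_sigma_additive.

End EmpiricalMeasure.

Definition semicircle_density {R : realType} (x : R) : R :=
  (2 * pi)^-1 * Num.sqrt (4 - x ^+ 2).

(* Main.v *)
Require Import Defs.
From HB Require Import structures.
From mathcomp Require Import all_boot all_order all_algebra.
From mathcomp Require Import complex ring lra zify.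
From mathcomp Require Import all_classical all_reals all_analysis measurable_realfun.
From mathcomp Require spectral mpoly.
Import -(notations) mpoly.

Set Implicit Arguments.
Unset Strict Implicit.
Unset Printing Implicit Defensive.

Import Order.TTheory GRing.Theory Num.Theory.
Import numFieldNormedType.Exports.
Local Open Scope classical_set_scope.
Local Open Scope ring_scope.

(** The proof is the moment method, with the moments computed by Gaussian
    integration by parts.

    At time [1 / n] the entries of the Hermitian Brownian motion [H] are centred
    Gaussian variables, and each entry is correlated only with its conjugate, with
    covariance [1 / n].  Hence [E (H a b * p) = E (entry_deriv a b p) / n] for
    every polynomial [p] in the entries.  Applied to a product of traces of powers
    of [H], this is the loop equation [loop_equation]: normalised by [1 / n], the
    expectation of [tr H ^ (k + 1)] times other traces is the sum over [r < k] of
    the expectations with [tr H ^ (k + 1)] replaced by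
    [tr H ^ r * tr H ^ (k - 1 - r)], up to terms of order [n ^ -2] in which two
    traces merge.  Since all terms on the right have smaller degree, an induction
    over all products of traces at once ([cvg_loop]) shows that these expectations
    converge to products of numbers [c k] with [c 0 = 1] and
    [c (k + 1) = sum_(r < k) c r * c (k - 1 - r)].

    The moments of the semicircle law are such numbers: integration by parts gives
    the linear recurrence [(k + 4) c (k + 2) = 4 (k + 1) c k], which implies the
    quadratic one ([semicircle_moment_catalan]).

    Moments determine the limit because the semicircle law has compact support: a
    bounded continuous function lies between two polynomials whose semicircle
    integrals are arbitrarily close ([polynomial_sandwich]).

    Three facts connect this with the eigenvalues: the power sums of the
    eigenvalues are the traces of the powers of [H]
    ([mxtrace_power_eigenvalues]); ordered eigenvalues are measurable because their
    power sums are ([measurable_sorted]), so that the expectations are additive;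
    and products of functions of independent variables have the product of the
    expectations as expectation ([expectation_prod]). *)

(** * A linear recurrence for the Catalan convolution *)

Section MomentRecurrence.
Variable (F : numFieldType) (m : nat -> F).
Hypothesis m0 : m 0%N = 1.
Hypothesis m1 : m 1%N = 0.
Hypothesis mSS : forall k, k.+4%:R * m k.+2 = 4 * k.+1%:R * m k.

Let s k := \sum_(r < k.+1) m r * m (k - r)%N.

(** Exchanging [r] and [k - r] shows that the weight [r] averages to [k / 2]. *)
Let weighted_conv (a : F) k :
  \sum_(r < k.+1) (r%:R + a) * (m r * m (k - r)%N) = (k%:R / 2 + a) * s k.
Proof.
have sym : \sum_(r < k.+1) r%:R * (m r * m (k - r)%N)
         = \sum_(r < k.+1) (k%:R - r%:R) * (m r * m (k - r)%N).
  rewrite (reindex_inj rev_ord_inj) /=; apply: eq_bigr => r _.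
  have rk : (r <= k)%N by rewrite -ltnS.
  by rewrite subSS natrB// subKn// [m (k - r)%N * _]mulrC.
have -> : \sum_(r < k.+1) (r%:R + a) * (m r * m (k - r)%N)
        = \sum_(r < k.+1) r%:R * (m r * m (k - r)%N) + a * s k.
  by rewrite mulr_sumr -big_split; apply: eq_bigr => r _; rewrite mulrDl.
rewrite mulrDl; congr (_ + _).
have : 2 * \sum_(r < k.+1) r%:R * (m r * m (k - r)%N) = k%:R * s k.
  rewrite mulr2n mulrDl !mul1r {1}sym -big_split mulr_sumr.
  by apply: eq_bigr => r _ /=; rewrite -mulrDl subrK.
by move=> h; rewrite mulrAC -h mulrAC mulfV ?pnatr_eq0// mul1r.
Qed.

(** The weight [2 (r + 2)] averages to [k + 4] in the self-convolution of [m], and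
    the linear recurrence absorbs the factor [r + 2]; hence the self-convolution
    obeys the recurrence of the shifted sequence [m], and by strong induction
    the two agree. *)
Lemma quadratic_of_linear_recurrence k :
  m k.+1 = \sum_(r < k) m r * m (k.-1 - r)%N.
Proof.
case: k => [|k]; first by rewrite big_ord0 m1.
change (m k.+2 = s k).
elim/ltn_ind: k => k IH.
have k4 : k.+4%:R != 0 :> F by rewrite pnatr_eq0.
apply: (mulfI k4); rewrite mSS.
have -> : k.+4%:R * s k = 2 * \sum_(r < k.+1) (r%:R + 2) * (m r * m (k - r)%N).
  by rewrite weighted_conv -[in LHS]addn4 natrD; field.
case: k IH k4 => [|[|k]] IH k4.
- by rewrite big_ord_recl big_ord0 /= m0; ring.
- by rewrite !big_ord_recl big_ord0 /= /bump /= m1; ring.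
rewrite 2!big_ord_recl /= /bump /= m1 mul0r mulr0 !add0r subn0 m0 mul1r.
have -> : \sum_(i < k.+1) ((1 + (1 + i))%:R + 2) *
     (m (1 + (1 + i))%N * m (k.+2 - (1 + (1 + i)))%N) = 4 * \sum_(i < k.+1) (i%:R + 1) * (m i * m (k - i)%N) :> F.
  rewrite mulr_sumr; apply: eq_bigr => i _.
  rewrite !add1n !subSS [in RHS]natr1 mulrA -natrD addn2 mSS.
  by rewrite !mulrA.
rewrite weighted_conv -IH// -[k.+3]addn3 natrD.
by field.
Qed.

End MomentRecurrence.

(** * Moments of the semicircle law *)

Section SemicircleMoments.
Variable R : realType.
Notation mu := (@lebesgue_measure R).
Implicit Types (x : R) (k : nat).

Let g x : R := Num.sqrt (4 - x ^+ 2).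

Let continuous_g : continuous g.
Proof.
move=> x; apply: (@continuous_comp _ _ _ (fun x : R => 4 - x ^+ 2) Num.sqrt).
  apply: continuousB; first exact: cst_continuous.
  exact: exprn_continuous.
exact: sqrt_continuous.
Qed.

Lemma continuous_semicircle_density : continuous (@semicircle_density R).
Proof.
move=> x; apply: (@continuousM _ _ (cst (2 * pi)^-1) g x); first exact: cst_continuous.
exact: continuous_g.
Qed.

Lemma integrable_mul_semicircle (h : R -> R) : continuous h ->
  mu.-integrable `[-2, 2] (EFin \o (fun x => h x * semicircle_density x)).
Proof.
move=> ch; apply: continuous_compact_integrable; first exact: segment_compact.
apply: continuous_subspaceT => x.
by apply: (@continuousM _ _ h (@semicircle_density R));
  [exact: ch | exact: continuous_semicircle_density].
Qed.

Definition semicircle_moment k : R :=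
  \int[mu]_(x in `[-2, 2]) (x ^+ k * semicircle_density x).

Let gE x : x \in `]-2, 2[ -> 0 < 4 - x ^+ 2.
Proof. by rewrite in_itv/= => /andP[? ?]; nra. Qed.

Let primitive k : R -> R := (@id R) ^+ k * g ^+ 3.

Let primitive_deriv k x : R :=
  (k%:R * 4 * x ^+ k.-1 - (k%:R + 3) * x ^+ k.+1) * g x.

(** The function [x ^ k (4 - x ^ 2) ^ (3 / 2)] vanishes at both endpoints, so its
    derivative has integral 0 over [-2, 2]: this is the moment recurrence. *)
Let is_derive_primitive k x : x \in `]-2, 2[ ->
  is_derive x 1 (primitive k) (primitive_deriv k x).
Proof.
move=> /gE h.
have dg : is_derive x 1 g (- x / g x).
  have d1 : is_derive x 1 (fun x : R => 4 - x ^+ 2) (- (2 * x)).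
    by apply: is_derive_eq; rewrite /GRing.scale/=; ring.
  have d2 := is_derive1_sqrt h.
  have := @is_derive1_comp _ Num.sqrt (fun x : R => 4 - x ^+ 2) x _ _ d2 d1.
  move=> d; apply: (is_derive_eq d).
  rewrite /g; have : Num.sqrt (4 - x ^+ 2) != 0 by rewrite gt_eqF// sqrtr_gt0.
  by move=> ?; field.
apply: is_derive_eq.
rewrite /GRing.scale/= /primitive_deriv !exprfctE /=.
have g0 : g x != 0 by rewrite gt_eqF// sqrtr_gt0.
have g2 : g x ^+ 2 = 4 - x ^+ 2 by rewrite sqr_sqrtr// ltW.
have -> : g x ^+ 3 = (4 - x ^+ 2) * g x by rewrite -g2 exprSr.
transitivity (((4 - x ^+ 2) * k%:R * x ^+ k.-1 - 3 * x ^+ k.+1) * g x).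
  by rewrite (exprS x k); field.
congr (_ * _); case: k => [|k] /=; first by ring.
by rewrite !exprS -natr1; ring.
Qed.

Let continuous_primitive_deriv k : continuous (primitive_deriv k).
Proof.
move=> x.
apply: (@continuousM _ _ (fun x : R => k%:R * 4 * x ^+ k.-1 - (k%:R + 3) * x ^+ k.+1) g);
  last exact: continuous_g.
by apply: continuousB; apply: continuousM;
  [exact: cst_continuous|exact: exprn_continuous|exact: cst_continuous|exact: exprn_continuous].
Qed.

Let integral_primitive_deriv k :
  \int[mu]_(x in `[-2, 2]) primitive_deriv k x = 0.
Proof.
have g2 : g 2 = 0 by rewrite /g (_ : 4 - 2 ^+ 2 = 0) ?sqrtr0//; ring.
have gN2 : g (-2) = 0 by rewrite /g (_ : 4 - (-2) ^+ 2 = 0) ?sqrtr0//; ring.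
have cp : continuous (primitive k).
  move=> x; rewrite /primitive.
  apply: (@continuousM _ _ ((@id R) ^+ k) (g ^+ 3)).
    by rewrite exprfctE; exact: exprn_continuous.
  rewrite exprfctE.
  apply: (@continuous_comp _ _ _ g (fun y => y ^+ 3)); first exact: continuous_g.
  exact: exprn_continuous.
rewrite /Rintegral (@continuous_FTC2 _ _ (primitive k)).
- by rewrite /= /primitive !fctE g2 gN2 expr0n !mulr0 subrr.
- by lra.
- exact/continuous_subspaceT/continuous_primitive_deriv.
- split.
  + by move=> x /(is_derive_primitive k) [].
  + by apply: cvg_at_right_filter; exact: cp.
  + by apply: cvg_at_left_filter; exact: cp.
- by move=> x /(is_derive_primitive k) d; rewrite derive1E derive_val.
Qed.

Let integrable_scaled (c : R) k : mu.-integrable `[-2, 2]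
  (EFin \o (fun x : R => c * (x ^+ k * semicircle_density x))).
Proof.
have := integrable_mul_semicircle (@exprn_continuous _ k).
move=> i0; have /= i := @integrableZl _ _ _ mu `[-2, 2] _ c _ i0.
exact: i.
Qed.

Lemma semicircle_moment_rec k :
  k.+4%:R * semicircle_moment k.+2 = 4 * k.+1%:R * semicircle_moment k.
Proof.
have E := integral_primitive_deriv k.+1.
apply/eqP; rewrite -subr_eq0 -oppr_eq0 opprB; apply/eqP.
rewrite /semicircle_moment -!RintegralZl//;
  [|exact: integrable_mul_semicircle (@exprn_continuous _ _)..].
rewrite -RintegralB//.
transitivity (\int[mu]_(x in `[-2, 2]) ((2 * pi)^-1 * primitive_deriv k.+1 x)).
  apply: eq_Rintegral => x _; rewrite /primitive_deriv /semicircle_density -/(g x) /=.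
  by rewrite -[k.+4]addn4 -[k.+1]addn1 !natrD; ring.
rewrite RintegralZl ?E ?mulr0//.
apply: continuous_compact_integrable; first exact: segment_compact.
exact/continuous_subspaceT/continuous_primitive_deriv.
Qed.

Lemma semicircle_moment1 : semicircle_moment 1 = 0.
Proof.
transitivity (\int[mu]_(x in `[-2, 2]) (- (6 * pi)^-1 * primitive_deriv 0 x)).
  apply: eq_Rintegral => x _; rewrite /primitive_deriv /semicircle_density -/(g x) /=.
  have p0 : (pi : R) != 0 by rewrite gt_eqF// pi_gt0.
  by move: (pi : R) p0 => p p0; field.
rewrite RintegralZl ?integral_primitive_deriv ?mulr0//.
apply: continuous_compact_integrable; first exact: segment_compact.
exact/continuous_subspaceT/continuous_primitive_deriv.
Qed.

(** The substitution [x = 2 sin y] is smooth up to the endpoints, where the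
    arcsine in the usual primitive is not differentiable. *)
Let integral_g : \int[mu]_(x in `[-2, 2]) g x = 2 * pi.
Proof.
have pi0 : 0 < pi :> R := pi_gt0 R.
pose F : R -> R := 2 \*o sin.
have dF x : is_derive x 1 F (2 * cos x).
  exact: is_derive_eq.
have F'E : (derive1 F) = fun x => 2 * cos x.
  by apply/funext => x; rewrite derive1E derive_val.
have cF : continuous F.
  by move=> x; apply: differentiable_continuous; apply/derivable1_diffP; case: (dF x).
have cF' : continuous (derive1 F).
  rewrite F'E => x; apply: (@continuousM _ _ (cst 2) (@cos R)); first exact: cst_continuous.
  exact: continuous_cos.
have FN : F (- (pi / 2)) = -2 by rewrite /F/= sinN sin_pihalf mulrN mulr1.
have FP : F (pi / 2) = 2 by rewrite /F/= sin_pihalf mulr1.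
have := @integration_by_substitution_increasing _ F g (- (pi / 2)) (pi / 2).
rewrite FN FP /Rintegral => ->; first last.
- exact: continuous_subspaceT.
- split.
  + by move=> x _; case: (dF x).
  + by apply: cvg_at_right_filter; exact: cF.
  + by apply: cvg_at_left_filter; exact: cF.
- by apply/cvg_ex; eexists; apply: cvg_at_left_filter; exact: cF'.
- by apply/cvg_ex; eexists; apply: cvg_at_right_filter; exact: cF'.
- by move=> x _; exact: cF'.
- move=> x y xi yi xy; rewrite /F/= ltr_pM2l//.
  by rewrite ltr_sin.
- lra.
pose G : R -> R := 2 \*o (id + sin * cos).
have dG x : is_derive x 1 G (4 * cos x ^+ 2).
  apply: is_derive_eq; rewrite /GRing.scale/=.
  have := cos2Dsin2 x; nra.
transitivity (fine (\int[mu]_(x in `[(- (pi / 2))%R, (pi / 2)%R]) (4 * cos x ^+ 2)%:E)%E).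
  congr fine; apply: eq_integral => x; rewrite inE/= in_itv/= => xi.
  rewrite !fctE F'E /F /g/=.
  have -> : 4 - (2 * sin x) ^+ 2 = (2 * cos x) ^+ 2.
    have := cos2Dsin2 x; nra.
  rewrite sqrtr_sqr ger0_norm; last first.
    by rewrite mulr_ge0// cos_ge0_pihalf.
  by congr EFin; ring.
rewrite (@continuous_FTC2 _ _ G).
- rewrite /G !fctE/= cosN cos_pihalf !mulr0 !addr0.
  by field.
- lra.
- apply: continuous_subspaceT => x.
  apply: (@continuousM _ _ (cst 4) (fun y : R => cos y ^+ 2)); first exact: cst_continuous.
  apply: (@continuous_comp _ _ _ (@cos R) (fun y => y ^+ 2)); first exact: continuous_cos.
  exact: exprn_continuous.
- have cG : continuous G.
    by move=> x; apply: differentiable_continuous; apply/derivable1_diffP; case: (dG x).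
  split.
  + by move=> x _; case: (dG x).
  + by apply: cvg_at_right_filter; exact: cG.
  + by apply: cvg_at_left_filter; exact: cG.
- by move=> x _; rewrite derive1E derive_val.
Qed.

Lemma semicircle_moment0 : semicircle_moment 0 = 1.
Proof.
transitivity (\int[mu]_(x in `[-2, 2]) ((2 * pi)^-1 * g x)).
  by apply: eq_Rintegral => x _; rewrite expr0 mul1r.
rewrite RintegralZl// ?integral_g ?mulVf//.
- by rewrite gt_eqF// mulr_gt0// pi_gt0.
apply: continuous_compact_integrable; first exact: segment_compact.
exact/continuous_subspaceT/continuous_g.
Qed.

Lemma semicircle_moment_catalan k : semicircle_moment k.+1 =
  \sum_(r < k) semicircle_moment r * semicircle_moment (k.-1 - r)%N.
Proof.
apply: quadratic_of_linear_recurrence.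
- exact: semicircle_moment0.
- exact: semicircle_moment1.
- exact: semicircle_moment_rec.
Qed.

End SemicircleMoments.

(** * Weierstrass approximation *)

Section Weierstrass.
Variable R : realType.

(** Uniform continuity handles close points, and boundedness the others; the
    error is put in quadratic form because the second moment of the Bernstein
    weights is explicit. *)
Lemma quadratic_modulus (h : R -> R) (a b e : R) : a <= b -> 0 < e ->
  continuous h ->
  exists2 C, 0 <= C & forall x y, x \in `[a, b] -> y \in `[a, b] ->
    `|h x - h y| <= e + C * (x - y) ^+ 2.
Proof.
move=> ab e0 ch.
have [d d0 hd] : exists2 d : R, 0 < d & forall x, x \in `[a, b] ->
    forall y, `|x - y| < d -> `|h x - h y| < e.
  have := (compact_near_coveringP `[a, b]%classic).1 (@segment_compact _ a b).
  move=> /(_ _ (0^'+) (fun d x => forall y, `|x - y| < d -> `|h x - h y| < e)).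
  case.
    move=> x _.
    have e2 : 0 < e / 2 by rewrite divr_gt0.
    have /cvgrPdist_lt/(_ _ e2)/nbhs_ballP[r /= r0 hr] := ch x.
    exists (ball x (r / 2), [set d | d < r / 2]) => /=.
      by split; [exact/nbhsx_ballx/divr_gt0|exact/nbhs_right_lt/divr_gt0].
    move=> -[x' d] /= [xx' dr] y x'y.
    have hx' : `|h x - h x'| < e / 2.
      by apply: hr; apply: le_ball xx'; rewrite ler_pdivrMr// ler_peMr// ?ltW//; lra.
    have hy : `|h x - h y| < e / 2.
      apply: hr; move: xx'; rewrite /ball/= => xx'.
      by rewrite (le_lt_trans (ler_distD x' _ _))// (splitr r) ltrD// (lt_trans x'y).
    by rewrite (le_lt_trans (ler_distD (h x) _ _))// (splitr e) ltrD// distrC.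
  move=> d /= d0 /(_ _)/= hd.
  exists (d / 2); first by rewrite divr_gt0.
  move=> x xab; apply: (hd (d / 2)) => //=; last by rewrite divr_gt0.
  by rewrite sub0r normrN gtr0_norm ?divr_gt0// ltr_pdivrMr// ltr_pMr//; lra.
have [c _ hc] := @EVT_max _ (fun x => `|h x|) _ _ ab
   (continuous_subspaceT (fun x => @cvg_norm _ _ _ _ _ _ _ (ch x))).
pose K := `|h c|.
have K0 : 0 <= 2 * K by rewrite mulr_ge0// normr_ge0.
have C0 : 0 <= 2 * K / d ^+ 2 by rewrite divr_ge0// exprn_ge0// ltW.
exists (2 * K / d ^+ 2) => //.
move=> x y xab yab.
have [xy|xy] := ltP `|x - y| d.
  by rewrite (le_trans (ltW (hd _ xab _ xy)))// lerDl mulr_ge0// sqr_ge0.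
have h2K : `|h x - h y| <= 2 * K.
  by rewrite mulr2n mulrDl !mul1r (le_trans (ler_normB _ _))// lerD// hc.
rewrite (le_trans h2K)// -[leLHS]add0r lerD ?(ltW e0)//.
rewrite mulrAC ler_pdivlMr ?exprn_gt0// ler_wpM2l// -[leRHS]real_normK ?num_real//.
by rewrite ler_sqr ?nnegrE ?(ltW d0).
Qed.

(** The Bernstein operator of degree [N], written through the recursion
    [B_(N+1) u = x B_N (u o succ) + (1 - x) B_N u] rather than with binomial
    coefficients: positivity and second moments then follow by induction. *)
Fixpoint bernstein (N : nat) (u : nat -> R) : {poly R} :=
  if N is N'.+1 then 'X * bernstein N' (u \o succn) + (1 - 'X) * bernstein N' u
  else (u 0%N)%:P.

Lemma ler_bernstein N (u v : nat -> R) x : 0 <= x <= 1 ->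
  (forall k, (k <= N)%N -> u k <= v k) ->
  (bernstein N u).[x] <= (bernstein N v).[x].
Proof.
move=> /andP[x0 x1]; elim: N u v => [|N IH] u v uv /=; first by rewrite !hornerC uv.
rewrite !hornerE/=; apply: lerD; apply: ler_wpM2l => //.
- by apply: IH => k kN; exact: uv.
- by rewrite subr_ge0.
- by apply: IH => k kN; apply: uv; exact: leqW.
Qed.

Lemma bernstein_quadratic N (a b c x : R) :
  (bernstein N (fun k => a + b * k%:R + c * k%:R ^+ 2)).[x] =
  a + b * (N%:R * x) + c * (N%:R * x * (1 - x) + (N%:R * x) ^+ 2).
Proof.
elim: N a b c => [|N IH] a b c /=; first by rewrite hornerC; ring.
have -> : (fun k : nat => a + b * k%:R + c * k%:R ^+ 2) \o succn =
     (fun k => (a + b + c) + (b + 2 * c) * k%:R + c * k%:R ^+ 2).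
  by apply/funext => k /=; rewrite -natr1; ring.
by rewrite !hornerE/= !IH -natr1; ring.
Qed.

(** The Bernstein operator is positive, so the bound of [quadratic_modulus] on
    [h x - h (k / N)] passes to the polynomial, where the quadratic term is
    [C x (1 - x) / N]. *)
Lemma weierstrass01 (h : R -> R) (e : R) : 0 < e -> continuous h ->
  exists p : {poly R}, forall x, 0 <= x <= 1 -> `|h x - p.[x]| <= e.
Proof.
move=> e0 ch.
have e2 : 0 < e / 2 by rewrite divr_gt0.
have [C C0 hC] := quadratic_modulus ler01 e2 ch.
pose N := (Num.truncn (C / (e / 2))).+1.
have N0 : 0 < N%:R :> R by rewrite ltr0n.
have CN : C / N%:R <= e / 2.
  by rewrite ler_pdivrMr// mulrC -ler_pdivrMr// ltW// truncnS_gt.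
pose u k := h (k%:R / N%:R).
exists (bernstein N u) => x x01.
have hu k : (k <= N)%N -> `|h x - u k| <= e / 2 + C * (x - k%:R / N%:R) ^+ 2.
  move=> kN; apply: hC; rewrite in_itv//=.
  by rewrite divr_ge0 ?ler0n//= ler_pdivrMr// mul1r ler_nat.
have B (a b : R) : (bernstein N (fun k => a + b * (e / 2 + C * (x - k%:R / N%:R) ^+ 2))).[x]
    = a + b * (e / 2 + C * (x * (1 - x)) / N%:R).
  have -> : (fun k : nat => a + b * (e / 2 + C * (x - k%:R / N%:R) ^+ 2)) =
    (fun k => (a + b * (e / 2) + b * C * x ^+ 2) + (- 2 * b * C * x / N%:R) * k%:R
       + (b * C / N%:R ^+ 2) * k%:R ^+ 2).
    by apply/funext => k; field; rewrite gt_eqF.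
  by rewrite bernstein_quadratic; field; rewrite gt_eqF.
have xx : C * (x * (1 - x)) / N%:R <= e / 2.
  apply: le_trans CN; rewrite ler_pM2r ?invr_gt0// ler_piMr//.
  by case/andP: x01 => ? ?; nra.
rewrite ler_distlC; apply/andP; split.
- apply: le_trans (_ : h x - e <= h x + - 1 * (e / 2 + C * (x * (1 - x)) / N%:R)) _.
    by lra.
  rewrite -B; apply: ler_bernstein => // k /hu; rewrite ler_distlC => /andP[? ?]; lra.
- apply: (@le_trans _ _ (h x + 1 * (e / 2 + C * (x * (1 - x)) / N%:R))); last by lra.
  rewrite -B; apply: ler_bernstein => // k /hu; rewrite ler_distlC => /andP[? ?]; lra.
Qed.

Theorem weierstrass (h : R -> R) (M e : R) : 0 < M -> 0 < e -> continuous h ->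
  exists p : {poly R}, forall x, `|x| <= M -> `|h x - p.[x]| <= e.
Proof.
move=> M0 e0 ch.
have [] := @weierstrass01 (fun y => h (2 * M * y - M)) e e0.
  move=> y; apply: (@continuous_comp _ _ _ (fun y => 2 * M * y - M) h); last exact: ch.
  apply: continuousB; last exact: cst_continuous.
  by apply: (@continuousM _ _ (cst (2 * M)) id); [exact: cst_continuous|exact: id].
move=> p hp; exists (p \Po ((2 * M)^-1 *: ('X + M%:P))) => x.
rewrite ler_norml => /andP[xM1 xM2].
have := hp ((2 * M)^-1 * (x + M)).
rewrite horner_comp !hornerE/=.
have -> : 2 * M / (2 * M) * (x + M) - M = x by field; rewrite gt_eqF.
apply; rewrite mulrC ler_pdivlMr ?mulr_gt0// ler_pdivrMr ?mulr_gt0//.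
by apply/andP; split; lra.
Qed.

End Weierstrass.

(** * Convergence to the semicircle law from convergence of moments *)

Section MomentMethod.
Variable R : realType.
Notation mu := (@lebesgue_measure R).

Definition semicircle_integral (g : R -> R) : R :=
  \int[mu]_(x in `[-2, 2]) (g x * semicircle_density x).

Let density_ge0 (x : R) : 0 <= semicircle_density x.
Proof. by rewrite mulr_ge0// ?sqrtr_ge0// invr_ge0 mulr_ge0// pi_ge0. Qed.

Lemma le_semicircle_integral (g h : R -> R) : continuous g -> continuous h ->
  (forall x, -2 <= x <= 2 -> g x <= h x) ->
  semicircle_integral g <= semicircle_integral h.
Proof.
move=> cg ch gh; apply: le_Rintegral => //; try exact: integrable_mul_semicircle.
by move=> x /=; rewrite in_itv/= => xI; rewrite ler_wpM2r// gh.
Qed.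

Lemma semicircle_integralD (g h : R -> R) : continuous g -> continuous h ->
  semicircle_integral (fun x => g x + h x) =
  semicircle_integral g + semicircle_integral h.
Proof.
move=> cg ch; rewrite /semicircle_integral.
under eq_Rintegral do rewrite mulrDl.
by rewrite RintegralD//; exact: integrable_mul_semicircle.
Qed.

Lemma semicircle_integralZ c (g : R -> R) : continuous g ->
  semicircle_integral (fun x => c * g x) = c * semicircle_integral g.
Proof.
move=> cg; rewrite /semicircle_integral.
under eq_Rintegral do rewrite -mulrA.
by rewrite RintegralZl//; exact: integrable_mul_semicircle.
Qed.

Let continuous_horner (p : {poly R}) : continuous (horner p).
Proof.
move=> x; apply: differentiable_continuous; apply/derivable1_diffP.
exact: derivable_horner.
Qed.

Lemma semicircle_integral_poly (p : {poly R}) :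
  semicircle_integral (horner p) = \sum_(i < size p) p`_i * semicircle_moment R i.
Proof.
have cX (q : {poly R}) : continuous (horner q) by exact: continuous_horner.
have E n (c : nat -> R) : semicircle_integral (horner (\sum_(i < n) c i *: 'X^i)) =
    \sum_(i < n) c i * semicircle_moment R i.
  elim: n => [|n IH].
    rewrite !big_ord0 (_ : horner 0 = fun x => 0 * 1); last first.
      by apply/funext => x; rewrite horner0 mul0r.
    by rewrite semicircle_integralZ ?mul0r// => x; exact: cst_continuous.
  rewrite !big_ord_recr /= -IH.
  have -> : horner (\sum_(i < n) c i *: 'X^i + c n *: 'X^n) =
     (fun x => (\sum_(i < n) c i *: 'X^i).[x] + c n * x ^+ n).
    by apply/funext => x; rewrite hornerD hornerZ hornerXn.
  rewrite semicircle_integralD// ?semicircle_integralZ//.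
  - exact: exprn_continuous.
  - by move=> x; apply: (@continuousM _ _ (cst (c n)) (fun x : R => x ^+ n));
      [exact: cst_continuous|exact: exprn_continuous].
by rewrite -E -poly_def coefK.
Qed.

(** A polynomial [p] close to [f] on [-3, 3] is corrected by a multiple of
    [(x / 3) ^ (2 m)], which dominates [f - p] outside [-3, 3] but is at most
    [(4 / 9) ^ m] on the support [-2, 2] of the limit law. *)
Lemma polynomial_sandwich (f : R -> R) (B e : R) : continuous f ->
  (forall x, `|f x| <= B) -> 0 < e ->
  exists p q : {poly R}, [/\ forall x, p.[x] <= f x, forall x, f x <= q.[x] &
    semicircle_integral (horner q) <= semicircle_integral (horner p) + e].
Proof.
move=> cf fB e0.
have e4 : 0 < e / 4 by rewrite divr_gt0.
have B0 : 0 <= B := le_trans (normr_ge0 _) (fB 0).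
have [p hp] := @weierstrass R f 3 (e / 4) (ltr0n _ _) e4 cf.
pose C := B + \sum_(i < size p) `|p`_i| * 3 ^+ i.
have C0 : 0 <= C by rewrite addr_ge0// sumr_ge0// => i _; rewrite mulr_ge0// exprn_ge0.
have [m pm Cm] : exists2 m, (size p <= m)%N & C * (4 / 9) ^+ m <= e / 4.
  have h : (fun m => C * (4 / 9) ^+ m) @ \oo --> (0 : R).
    rewrite -(mulr0 C); apply: cvgMr; apply: cvg_expr; rewrite ger0_norm; lra.
  have /cvgrPdist_le/(_ _ e4)[N _ hN] := h.
  exists (maxn N (size p)); first exact: leq_maxr.
  have := hN (maxn N (size p)) (leq_maxl _ _).
  by rewrite sub0r normrN => /(le_trans (ler_norm _)).
have [t tE] : exists t : {poly R}, forall x, t.[x] = e / 4 + C * (x / 3) ^+ (2 * m).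
  exists ((e / 4)%:P + C *: ((1 / 3) *: 'X) ^+ (2 * m)) => x.
  by rewrite !hornerE [_^-1 * x]mulrC.
have even_ge0 (x : R) : 0 <= x ^+ (2 * m) by rewrite exprM exprn_ge0// sqr_ge0.
have fpt x : `|f x - p.[x]| <= t.[x].
  rewrite tE; have [x3|x3] := leP `|x| 3.
    by rewrite (le_trans (hp _ x3))// lerDl mulr_ge0.
  rewrite (@le_trans _ _ (C * (x / 3) ^+ (2 * m)))//; last by rewrite lerDr ltW.
  have y1 : 1 <= `|x| / 3 by rewrite ler_pdivlMr// mul1r ltW.
  have -> : (x / 3) ^+ (2 * m) = (`|x| / 3) ^+ (2 * m).
    rewrite [LHS]exprM [RHS]exprM; congr (_ ^+ m).
    by rewrite !exprMn -normrX ger0_norm ?sqr_ge0.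
  rewrite (le_trans (ler_normB _ _))// /C mulrDl; apply: lerD.
    by rewrite (le_trans (fB x))// ler_peMr// exprn_ege1.
  rewrite horner_coef (le_trans (ler_norm_sum _ _ _))// mulr_suml; apply: ler_sum => i _.
  rewrite normrM -mulrA ler_wpM2l// normrX.
  have -> : `|x| ^+ i = 3 ^+ i * (`|x| / 3) ^+ i by rewrite -exprMn mulrC divfK.
  rewrite ler_wpM2l ?exprn_ge0//; apply: ler_weXn2l => //.
  by rewrite (leq_trans (ltnW (ltn_ord i)))// (leq_trans pm)// leq_pmull.
exists (p - t), (p + t); split.
- move=> x; rewrite hornerD ?hornerN; have := fpt x.
  by rewrite ler_distlC => /andP[h1 h2]; move: h1 h2; lra.
- move=> x; rewrite hornerD ?hornerN; have := fpt x.
  by rewrite ler_distlC => /andP[h1 h2]; move: h1 h2; lra.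
have ct : continuous (horner (t + t)) by exact: continuous_horner.
have -> : horner (p + t) = (fun x => (p - t).[x] + (t + t).[x]).
  by apply/funext => x; rewrite !hornerD hornerN -addrA addKr.
rewrite semicircle_integralD//.
rewrite lerD2l.
apply: (@le_trans _ _ (semicircle_integral (fun=> e * 1))).
  apply: le_semicircle_integral => //; first by move=> x; exact: cst_continuous.
  move=> x /andP[x1 x2]; rewrite hornerD tE.
  have : C * (x / 3) ^+ (2 * m) <= C * (4 / 9) ^+ m.
    have y2 : (x / 3) ^+ 2 <= 4 / 9 by rewrite expr_div_n; nra.
    by rewrite ler_wpM2l// exprM lerXn2r ?nnegrE ?sqr_ge0 ?divr_ge0.
  by lra.
rewrite semicircle_integralZ; last by move=> x; exact: cst_continuous.
suff -> : semicircle_integral (fun=> 1) = 1 by rewrite mulr1.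
rewrite -[RHS](@semicircle_moment0 R); apply: eq_Rintegral => x _.
by rewrite expr0.
Qed.

(** Convergence of moments passes to [f] through monotonicity alone: the values
    [u n] are only compared with those of polynomials below and above [f]. *)
Theorem moment_method (M : nat -> nat -> R) (u : nat -> R) (f : R -> R) (B : R) :
  continuous f -> (forall x, `|f x| <= B) ->
  (forall k, M ^~ k @ \oo --> semicircle_moment R k) ->
  (forall n (q : {poly R}), (forall x, q.[x] <= f x) ->
     \sum_(i < size q) q`_i * M n i <= u n) ->
  (forall n (q : {poly R}), (forall x, f x <= q.[x]) ->
     u n <= \sum_(i < size q) q`_i * M n i) ->
  u @ \oo --> semicircle_integral f.
Proof.
move=> cf fB cM lo up.
have cMq (q : {poly R}) : (fun n => \sum_(i < size q) q`_i * M n i) @ \oo -->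
    semicircle_integral (horner q).
  rewrite semicircle_integral_poly; apply: cvg_big; first exact: add_continuous.
  by move=> i _; apply: cvgM; [exact: cvg_cst|exact: cM].
apply/cvgrPdist_le => e e0.
have e2 : 0 < e / 2 by rewrite divr_gt0.
have [p [q [pf fq pq]]] := polynomial_sandwich cf fB e2.
have pfI : semicircle_integral (horner p) <= semicircle_integral f.
  by apply: le_semicircle_integral => //; exact: continuous_horner.
have fqI : semicircle_integral f <= semicircle_integral (horner q).
  by apply: le_semicircle_integral => //; exact: continuous_horner.
have /cvgrPdist_le/(_ _ e2) hp := cMq p.
have /cvgrPdist_le/(_ _ e2) hq := cMq q.
near=> n.
have h1 := lo n p pf; have h2 := up n q fq.
have : `|semicircle_integral (horner p) - \sum_(i < size p) p`_i * M n i| <= e / 2 by near: n.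
rewrite ler_distlC => /andP[h3 h4].
have : `|semicircle_integral (horner q) - \sum_(i < size q) q`_i * M n i| <= e / 2 by near: n.
rewrite ler_distlC => /andP[h5 h6].
rewrite ler_distl; apply/andP; split; lra.
Unshelve. all: by end_near. Qed.

End MomentMethod.

(** * The loop equation *)

Section LoopEquation.
Variables (K C : comNzRingType) (n : nat) (H : 'M[K]_n).
Variables (E : {additive K -> C}) (D : 'I_n -> 'I_n -> {additive K -> K}) (s : C).
Hypothesis D_mul : forall a b p q, D a b (p * q) = D a b p * q + p * D a b q.
Hypothesis D_entry : forall a b c d, D a b (H c d) = (c == b)%:R * (a == d)%:R.
Hypothesis E_parts : forall a b p, E (H a b * p) = s * E (D a b p).

Definition power_trace k : K := \tr (H ^+ k).
Notation tr k := (power_trace k).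

Definition trace_prod (ks : seq nat) : K := \prod_(k <- ks) tr k.

(** Contracting one entry of the extra factor [H ^ k] with the trace of [H ^ x]
    merges the two into the trace of [H ^ (k + x - 1)], in [x] ways; each pair
    holds this multiplicity and the resulting list of exponents. *)
Fixpoint merges (k : nat) (ks : seq nat) : seq (nat * seq nat) :=
  if ks is x :: ks' then
    (x, (k + x).-1 :: ks') :: [seq (p.1, x :: p.2) | p <- merges k ks']
  else [::].

Let D1 a b : D a b 1 = 0.
Proof.
have := D_mul a b 1 1; rewrite !mulr1 mul1r => /eqP.
by rewrite -subr_eq0 opprD addrA subrr add0r oppr_eq0 => /eqP.
Qed.

Let D_power a b k c d : D a b ((H ^+ k) c d) =
  \sum_(r < k) (H ^+ r) c b * (H ^+ (k.-1 - r)) a d.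
Proof.
elim: k c d => [|k IH] c d.
  rewrite big_ord0 expr0 mxE; case: (c == d); first by rewrite mulr1n D1.
  by rewrite mulr0n raddf0.
rewrite exprS -mulmxE mxE raddf_sum big_ord_recl /= subn0.
under eq_bigr => x _ do rewrite D_mul D_entry IH.
rewrite big_split /=; congr (_ + _).
  rewrite (bigD1 a)//= eqxx mulr1 big1 ?addr0; last first.
    by move=> x xa; rewrite [a == x]eq_sym (negPf xa) mulr0 mul0r.
  by rewrite expr0 mxE.
under eq_bigr => x _ do rewrite mulr_sumr.
rewrite exchange_big /=; apply: eq_bigr => r _.
rewrite /bump /= add1n exprS -mulmxE mxE mulr_suml.
apply: eq_bigr => x _.
by rewrite mulrA; congr (_ * _ * (H ^+ _) _ _); case: k {IH} r => [[]//|k] r; rewrite subSS.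
Qed.

Let D_trace a b k : D a b (tr k) = k%:R * (H ^+ k.-1) a b.
Proof.
rewrite raddf_sum.
under eq_bigr => c _ do rewrite D_power.
rewrite exchange_big /= mulr_natl -[X in _ *+ X]card_ord -sumr_const.
apply: eq_bigr => r _.
transitivity ((H ^+ (k.-1 - r) *m H ^+ r) a b).
  by rewrite mxE; apply: eq_bigr => c _; rewrite mulrC.
rewrite mulmxE -exprD subnK//; case: k r => [[]//|k] r; exact: ltn_ord r.
Qed.

Let mxtrace_mulE (A B : 'M[K]_n) : \sum_a \sum_b A b a * B a b = \tr (B *m A).
Proof.
apply: eq_bigr => a _; rewrite mxE; apply: eq_bigr => b _.
by rewrite mulrC.
Qed.

Let contract_trace_prod k ks :
  \sum_a \sum_b (H ^+ k) b a * D a b (trace_prod ks)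
  = \sum_(p <- merges k ks) p.1%:R * trace_prod p.2.
Proof.
elim: ks => [|x ks IH] /=.
  rewrite big_nil big1// => a _; rewrite big1// => b _.
  by rewrite /trace_prod big_nil D1 mulr0.
rewrite big_cons big_map /= /trace_prod !big_cons -/(trace_prod ks).
under eq_bigr => a _ do under eq_bigr => b _ do
  rewrite D_mul D_trace mulrDr.
under eq_bigr => a _ do rewrite big_split.
rewrite big_split /=; congr (_ + _).
  transitivity (x%:R * trace_prod ks * \sum_a \sum_b (H ^+ k) b a * (H ^+ x.-1) a b).
    rewrite mulr_sumr; apply: eq_bigr => a _; rewrite mulr_sumr.
    by apply: eq_bigr => b _; ring.
  rewrite mxtrace_mulE mulmxE -exprD mulrAC -mulrA.
  case: x => [|x]; first by rewrite !mul0r.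
  by rewrite addnS /= addnC.
transitivity (tr x * \sum_a \sum_b (H ^+ k) b a * D a b (trace_prod ks)).
  rewrite mulr_sumr; apply: eq_bigr => a _; rewrite mulr_sumr.
  by apply: eq_bigr => b _; ring.
rewrite IH mulr_sumr; apply: eq_bigr => p _.
by rewrite /trace_prod big_cons; ring.
Qed.

(** Gaussian integration by parts, applied to the first entry of [H ^ k.+1]:
    differentiating the rest of that power splits its trace into two, and
    differentiating another trace merges it with the remaining [H ^ k]. *)
Theorem loop_equation k ks :
  E (trace_prod (k.+1 :: ks)) =
  s * (\sum_(r < k) E (trace_prod [:: val r, (k.-1 - r)%N & ks])
     + \sum_(p <- merges k ks) p.1%:R * E (trace_prod p.2)).
Proof.
rewrite /trace_prod big_cons -/(trace_prod ks).
have -> : tr k.+1 = \sum_a \sum_b H a b * (H ^+ k) b a.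
  rewrite /power_trace exprS -mulmxE; apply: eq_bigr => a _.
  by rewrite mxE.
rewrite mulr_suml raddf_sum.
under eq_bigr => a _.
  rewrite mulr_suml raddf_sum.
  under eq_bigr => b _ do rewrite -mulrA E_parts D_mul raddfD D_power mulr_suml.
  rewrite -mulr_sumr big_split.
  over.
rewrite -mulr_sumr big_split /=; congr (_ * (_ + _)).
  under eq_bigr => a _ do under eq_bigr => b _ do rewrite raddf_sum.
  under eq_bigr => a _ do rewrite exchange_big.
  rewrite exchange_big /=; apply: eq_bigr => r _.
  rewrite /trace_prod !big_cons -/(trace_prod ks).
  rewrite [power_trace _]/mxtrace [power_trace (_ - _)]/mxtrace.
  rewrite mulrA mulr_suml exchange_big /= mulr_suml raddf_sum; apply: eq_bigr => b _.
  rewrite mulr_sumr mulr_suml raddf_sum; apply: eq_bigr => a _.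
  by [].
transitivity (E (\sum_a \sum_b (H ^+ k) b a * D a b (trace_prod ks))).
  rewrite raddf_sum; apply: eq_bigr => a _; rewrite raddf_sum.
  by apply: eq_bigr.
rewrite contract_trace_prod raddf_sum; apply: eq_bigr => p _.
by rewrite !mulr_natl raddfMn.
Qed.

End LoopEquation.

(** * The limit of the loop equation *)

Section LoopLimit.
Variables (R : realType) (c : nat -> R) (G : nat -> seq nat -> R).
Hypothesis c0 : c 0%N = 1.
Hypothesis cS : forall k, c k.+1 = \sum_(r < k) c r * c (k.-1 - r)%N.
Hypothesis G_nil : forall n, G n [::] = 1.
Hypothesis G_zero : forall n ks, G n (0%N :: ks) = G n ks.
Hypothesis G_loop : forall n k ks, G n (k.+1 :: ks) =
  \sum_(r < k) G n [:: val r, (k.-1 - r)%N & ks]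
  + n.+1%:R ^- 2 * \sum_(p <- merges k ks) p.1%:R * G n p.2.

Lemma sumn_merges k ks p : p \in merges k ks ->
  (sumn p.2 <= k + sumn ks)%N /\ size p.2 = size ks.
Proof.
elim: ks p => [|x ks IH] p //=; rewrite inE => /predU1P[->/=|].
  by split=> //; rewrite addnA leq_add2r leq_pred.
by move=> /mapP[q /IH[h1 h2] ->] /=; rewrite h2; split=> //; rewrite addnCA leq_add2l.
Qed.

Let cvg_inv_sqr : (fun n : nat => n.+1%:R ^- 2 : R) @ \oo --> (0 : R).
Proof.
rewrite (_ : (fun n : nat => _) = (@harmonic R) \* (@harmonic R)); last first.
  by apply/funext => n /=; rewrite expr2 invfM.
by rewrite -(mulr0 0); apply: cvgM; exact: cvg_harmonic.
Qed.

(** Every term on the right of the loop equation has smaller total degree plus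
    length, so an induction over all products of traces at once gives both the
    limit and the factorisation, without any variance estimate. *)
Theorem cvg_loop ks : G ^~ ks @ \oo --> \prod_(k <- ks) c k.
Proof.
have [m] := ubnP (sumn ks + size ks); elim: m ks => // m IH [|[|k] ks] /= hm.
- rewrite big_nil; under eq_fun do rewrite G_nil.
  exact: cvg_cst.
- rewrite big_cons c0 mul1r; under eq_fun do rewrite G_zero.
  by apply: IH; lia.
under eq_fun do rewrite G_loop.
rewrite big_cons cS -[(\sum_(r < k) _) * _]addr0; apply: cvgD.
  rewrite mulr_suml; apply: cvg_big; first (by exact: add_continuous); move=> r _.
  rewrite -mulrA -!(big_cons _ _ _ _ xpredT c); apply: IH => /=.
  have rk : (r + (k.-1 - r) = k.-1)%N.
    by rewrite subnKC//; case: k r {hm} => [[]//|k] r; exact: ltn_ord r.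
  rewrite addnA rk; move: hm; case: k r {rk} => [[]//|k] r /= hm.
  by move: hm; lia.
suff h : (fun n => \sum_(p <- merges k ks) p.1%:R * G n p.2) @ \oo -->
    (\sum_(p <- merges k ks) p.1%:R * \prod_(j <- p.2) c j).
  by have := cvgM cvg_inv_sqr h; rewrite mul0r; exact.
rewrite big_seq; under eq_fun do rewrite big_seq.
apply: cvg_big; first exact: add_continuous.
move=> p hp; apply: cvgM; first exact: cvg_cst.
apply: IH; have [h1 ->] := sumn_merges hp.
by move: h1; move: (sumn p.2) (size ks) hm => a b hm h1; lia.
Qed.

End LoopLimit.

(** * Traces of powers and eigenvalues *)

Section TracePower.
Variable C : numClosedFieldType.

Let char_poly_similar n (A P : 'M[C]_n) : P \in unitmx ->
  char_poly (invmx P *m A *m P) = char_poly A.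
Proof.
move=> Pu; rewrite /char_poly.
have -> : char_poly_mx (invmx P *m A *m P) =
    map_mx polyC (invmx P) *m char_poly_mx A *m map_mx polyC P.
  rewrite /char_poly_mx mulmxBr mulmxBl -!map_mxM; congr (_ - _).
  by rewrite scalar_mxC -mulmxA -map_mxM mulVmx// map_mx1 mulmx1.
rewrite !det_mulmx mulrAC -det_mulmx -map_mxM mulVmx//.
by rewrite map_mx1 det1 mul1r.
Qed.

Let mxtrace_power_similar n (A P : 'M[C]_n) k : P \in unitmx ->
  \tr ((invmx P *m A *m P) ^+ k) = \tr (A ^+ k).
Proof.
move=> Pu.
have -> : (invmx P *m A *m P) ^+ k = invmx P *m A ^+ k *m P.
  elim: k => [|k IH]; first by rewrite !expr0 mulmx1 mulVmx.
  rewrite !exprS IH -!mulmxE -!mulmxA; congr (_ *m (_ *m _)).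
  by rewrite mulmxA mulmxV// mul1mx.
by rewrite -mulmxA mxtrace_mulC -mulmxA mulmxV// mulmx1.
Qed.

(** The spectral theorem diagonalises [A], and unique factorisation identifies the
    diagonal entries with the [x j] up to order. *)
Lemma mxtrace_power_eigenvalues n (A : 'M[C]_n) (x : 'I_n -> C) k :
  (forall i j, A i j = (A j i)^*) ->
  char_poly A = \prod_(j < n) ('X - (x j)%:P) ->
  \tr (A ^+ k) = \sum_(j < n) x j ^+ k.
Proof.
move=> Aherm Ax.
have AC : map_mx Num.conj (trmx A) = A by apply/matrixP => i j; rewrite !mxE -Aherm.
have /spectral.orthomx_spectralP AE : A \is spectral.normalmx.
  by apply/spectral.normalmxP; rewrite AC.
have Pu := spectral.spectral_unit A.
set P := spectral.spectralmx A in AE Pu.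
set sp := spectral.spectral_diag A in AE.
have diagX : diag_mx sp ^+ k = diag_mx (\row_j (sp 0 j) ^+ k).
  elim: k => [|k IH].
    by rewrite expr0; apply/matrixP => i j; rewrite !mxE expr0.
  rewrite exprS IH -mulmxE; apply/matrixP => i j; rewrite !mxE (bigD1 i)//= big1 ?addr0.
    by rewrite !mxE eqxx mulr1n exprS mulrnAr.
  by move=> l li; rewrite !mxE [i == l]eq_sym (negPf li) mulr0n mul0r.
rewrite {1}AE mxtrace_power_similar// diagX mxtrace_diag.
under eq_bigr do rewrite mxE.
move: Ax; rewrite {1}AE char_poly_similar// char_poly_trig ?diag_mx_is_trig//.
have -> : \prod_(i < n) ('X - (diag_mx sp i i)%:P) = \prod_(i < n) ('X - (sp 0 i)%:P).
  by apply: eq_bigr => i _; rewrite mxE eqxx mulr1n.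
have PE (y : 'I_n -> C) : \prod_(j < n) ('X - (y j)%:P) =
    \prod_(z <- map y (index_enum 'I_n)) ('X - z%:P) by rewrite big_map.
rewrite !PE => /prod_XsubC_eq sx.
have E (y : 'I_n -> C) : \sum_(j < n) y j ^+ k = \sum_(z <- map y (index_enum 'I_n)) z ^+ k.
  by rewrite big_map.
by rewrite !E; exact: perm_big.
Qed.

End TracePower.

(** * Measurability of ordered eigenvalues *)

Section OrderedMeasurable.
Context d (T : measurableType d) (R : realType) (n : nat) (x : 'I_n -> T -> R).
Hypothesis x_sorted : forall w (i j : 'I_n), (i <= j)%N -> x j w <= x i w.
Hypothesis power_sums : forall k, measurable_fun setT (fun w => \sum_(j < n) x j w ^+ k).

Let measurable_poly_sum (p : {poly R}) :
  measurable_fun setT (fun w => \sum_(j < n) p.[x j w]).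
Proof.
have -> : (fun w => \sum_(j < n) p.[x j w]) =
    (fun w => \sum_(i < size p) p`_i * \sum_(j < n) x j w ^+ i).
  apply/funext => w; under eq_bigr do rewrite horner_coef.
  by rewrite exchange_big; apply: eq_bigr => i _; rewrite mulr_sumr.
apply: measurable_sum => i; apply: measurable_funM => //.
Qed.

(** The approximating polynomials may depend on the range [[-m, m]]: only
    pointwise convergence in [w] is needed. *)
Let measurable_continuous_sum (g : R -> R) : continuous g ->
  measurable_fun setT (fun w => \sum_(j < n) g (x j w)).
Proof.
move=> cg.
have /choice[p hp] : forall m : nat, exists p : {poly R},
    forall y, `|y| <= m.+1%:R -> `|g y - p.[y]| <= (@harmonic R) m.
  by move=> m; apply: weierstrass => //; rewrite ?ltr0n// /harmonic/= invr_gt0 ltr0n.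
apply: (@measurable_fun_cvg _ _ _ _ (fun m w => \sum_(j < n) (p m).[x j w])) => //.
move=> w _; apply: cvg_big => [|i _]; first exact: add_continuous.
apply/subr_cvg0/norm_cvg0P.
apply: (@squeeze_cvgr _ _ _ _ (cst 0) (@harmonic R)); last 2 first.
- exact: cvg_cst.
- exact: cvg_harmonic.
near=> m; rewrite normr_ge0/= distrC; apply: hp.
near: m; exists (Num.truncn `|x i w|) => //= m hm.
by rewrite (le_trans (ltW (truncnS_gt _)))// ler_nat.
Unshelve. all: by end_near. Qed.

Let ramp (a : R) (m : nat) (y : R) : R := Num.min 1 (Num.max 0 (m%:R * (y - a))).

Let continuous_ramp a m : continuous (ramp a m).
Proof.
move=> y.
apply: (@continuous_min R R (cst 1) (cst 0 \max (fun y : R => m%:R * (y - a)))).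
  exact: cst_continuous.
apply: (@continuous_max R R (cst 0) (fun y : R => m%:R * (y - a))).
  exact: cst_continuous.
apply: (@continuousM _ _ (cst m%:R) (fun y : R => y - a)); first exact: cst_continuous.
by apply: (@continuousB _ _ _ id (cst a)); [exact: id|exact: cst_continuous].
Qed.

Let cvg_ramp a y : (ramp a)^~ y @ \oo --> ((a < y)%R%:R : R).
Proof.
have [ya|ay] := leP y a.
  apply: cvg_near_cst; apply: nearW => m; rewrite /ramp max_l ?min_r//.
  by rewrite mulr_ge0_le0// subr_le0.
apply: cvg_near_cst; near=> m.
have h : 1 <= m%:R * (y - a).
  rewrite -ler_pdivrMr ?subr_gt0// mul1r.
  near: m; exists (Num.truncn (y - a)^-1).+1 => //= m hm.
  by rewrite (le_trans (ltW (truncnS_gt _)))// ler_nat.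
by rewrite /ramp max_r ?min_l// (le_trans ler01).
Unshelve. all: by end_near. Qed.

Let measurable_count a :
  measurable_fun setT (fun w => \sum_(j < n) (a < x j w)%R%:R : R).
Proof.
apply: (@measurable_fun_cvg _ _ _ _ (fun m w => \sum_(j < n) ramp a m (x j w))) => //.
  by move=> m; apply: measurable_continuous_sum; exact: continuous_ramp.
move=> w _; apply: cvg_big => [|i _]; first exact: add_continuous.
exact: cvg_ramp.
Qed.

Let sum_initial_segment k : (k <= n)%N -> (\sum_(i < n) (i < k) = k)%N.
Proof.
move=> kn; under eq_bigr do rewrite -[nat_of_bool _]/(if _ then 1%N else 0%N).
by rewrite -big_mkcond (big_ord_narrow kn) sum_nat_const card_ord muln1.
Qed.

Let lt_count a w (j : 'I_n) :
  (a < x j w) = (j%:R < \sum_(i < n) (a < x i w)%R%:R :> R).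
Proof.
rewrite -natr_sum ltr_nat; have [h|h] := ltP a (x j w); apply/esym.
  rewrite -[X in (X <= _)%N](sum_initial_segment (ltn_ord j)).
  apply: leq_sum => i _; case: ltnP => // ij.
  by rewrite (lt_le_trans h)// x_sorted.
apply/negbTE; rewrite -leqNgt -[X in (_ <= X)%N](sum_initial_segment (ltnW (ltn_ord j))).
apply: leq_sum => i _; case: ltnP => ij; first by case: ltP.
by rewrite ltNge (le_trans _ h)// x_sorted.
Qed.

(** Ordered real roots are measurable functions of their power sums: sums of
    continuous functions over the roots are limits of sums of polynomials, the
    number of roots above [a] is a limit of such sums, and [x j] exceeds [a] iff
    more than [j] roots do. *)
Lemma measurable_sorted j : measurable_fun setT (x j).
Proof.
move=> mT; apply: (measurability _ (RGenOInfty.measurableE R)) => //.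
move=> /= _ [_ [a ->] <-]; rewrite setTI.
have -> : x j @^-1` `]a, +oo[ =
    (fun w => \sum_(i < n) (a < x i w)%R%:R : R) @^-1` `]j%:R, +oo[.
  by apply/seteqP; split => w /=; rewrite !in_itv/= !andbT lt_count.
rewrite -[X in measurable X]setTI; exact: measurable_count.
Qed.

End OrderedMeasurable.

(** * Change of measure and Gaussian moments *)

Section Density.
Import HBNNSimple.
Local Open Scope ereal_scope.
Context d d' (T : measurableType d) (U : measurableType d') (R : realType).
Variables (mu : {measure set T -> \bar R}) (nu : {measure set U -> \bar R}).
Variables (xi : T -> U) (W : T -> R).
Hypotheses (mxi : measurable_fun setT xi) (mW : measurable_fun setT W).
Hypothesis W0 : forall x, (0 <= W x)%R.
Hypothesis nuE : forall A, measurable A ->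
  nu A = \int[mu]_(x in xi @^-1` A) (W x)%:E.

Let integral_nnsfun_density (h : {nnsfun U >-> R}) :
  \int[nu]_y (h y)%:E = \int[mu]_x (h (xi x) * W x)%:E.
Proof.
transitivity (\int[nu]_y
   (\sum_(r \in range h) (r * \1_(h @^-1` [set r]) y)%:E)).
  by apply: eq_integral => y _; rewrite /= fimfunE -fsumEFin.
rewrite ge0_integral_fsum//; last 2 first.
- by move=> r; apply/measurable_EFinP; exact: measurable_funM.
- by move=> r y _; exact: nnfun_muleindic_ge0.
transitivity (\int[mu]_x
   (\sum_(r \in range h) (r * \1_(h @^-1` [set r]) (xi x) * W x)%:E)); last first.
  apply: eq_integral => x _.
  rewrite [in RHS]fimfunE EFinM -fsumEFin// ge0_mule_fsuml// => r.
  exact: nnfun_muleindic_ge0.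
have mi r : measurable_fun setT (fun x => (r * \1_(h @^-1` [set r]) (xi x) * W x)%:E).
  apply/measurable_EFinP; apply: measurable_funM => //.
  apply: measurable_funM => //.
  by apply: (measurableT_comp _ mxi).
rewrite ge0_integral_fsum//; last first.
  move=> r x _; rewrite EFinM mule_ge0 ?lee_fin//.
  exact: nnfun_muleindic_ge0.
apply: eq_fsbigr => r /[!inE] -[y _ <-].
under eq_integral do rewrite EFinM.
rewrite integralZl_indic_nnsfun// integral_indic// setIT nuE; last first.
  by apply: measurable_funPTI.
under [RHS]eq_integral do rewrite -mulrA EFinM.
rewrite ge0_integralZl//; first last.
- by rewrite lee_fin.
- by move=> x _; rewrite lee_fin mulr_ge0.
- by apply/measurable_EFinP; apply: measurable_funM => //; apply: (measurableT_comp _ mxi).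
congr (_ * _); rewrite integral_mkcond; apply: eq_integral => x _.
by rewrite epatch_indic /= muleC -EFinM indicE.
Qed.

(** With [xi] the identity this is integration against a density; with [W] a
    function of variables independent of [xi], it factors expectations. *)
Lemma ge0_integral_density (f : U -> R) : measurable_fun setT f ->
  (forall y, 0 <= f y)%R ->
  \int[nu]_y (f y)%:E = \int[mu]_x (f (xi x) * W x)%:E.
Proof.
move=> mf f0.
have mEf : measurable_fun setT (EFin \o f) by exact/measurable_EFinP.
pose h := nnsfun_approx measurableT mEf.
have hf y : EFin \o h^~ y @ \oo --> (f y)%:E.
  by apply: (cvg_nnsfun_approx measurableT mEf) => // z _; rewrite lee_fin.
transitivity (lim (\int[nu]_y (h n y)%:E @[n --> \oo])).
  rewrite -monotone_convergence//.
  - by apply: eq_integral => y _; apply/esym/cvg_lim => //; exact: hf.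
  - by move=> n; exact/measurable_EFinP.
  - by move=> n y _; rewrite lee_fin.
  - by move=> y _ a b ab; rewrite lee_fin; exact/lefP/nd_nnsfun_approx.
under eq_fun do rewrite integral_nnsfun_density.
rewrite -monotone_convergence//.
- apply: eq_integral => x _; apply/cvg_lim => //.
  rewrite EFinM; under eq_fun do rewrite EFinM.
  by apply: cvgeZr => //; exact: hf.
- move=> n; apply/measurable_EFinP; apply: measurable_funM => //.
  by apply: (measurableT_comp _ mxi).
- by move=> n x _; rewrite lee_fin mulr_ge0.
- move=> x _ a b ab; rewrite lee_fin ler_wpM2r//; exact/lefP/nd_nnsfun_approx.
Qed.

Lemma integrable_density (f : U -> R) : measurable_fun setT f ->
  nu.-integrable setT (EFin \o f) <->
  mu.-integrable setT (fun x => (f (xi x) * W x)%:E).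
Proof.
move=> mf; have E : \int[nu]_y `|(f y)%:E| = \int[mu]_x `|(f (xi x) * W x)%:E|.
  transitivity (\int[nu]_y (`|f y|)%:E); first by [].
  rewrite ge0_integral_density//; last exact: measurableT_comp.
  by apply: eq_integral => x _ /=; rewrite normrM (ger0_norm (W0 x)).
split => /integrableP[_ fi]; apply/integrableP; split.
- apply/measurable_EFinP; apply: measurable_funM => //.
  by apply: (measurableT_comp mf mxi).
- by rewrite -E.
- exact/measurable_EFinP.
- by rewrite E.
Qed.

(** The splitting [f = |f| - (|f| - f)] reduces to nonnegative functions. *)
Lemma integral_density (f : U -> R) : measurable_fun setT f ->
  nu.-integrable setT (EFin \o f) ->
  \int[nu]_y (f y)%:E = \int[mu]_x (f (xi x) * W x)%:E.
Proof.
move=> mf fi; have fWi := (integrable_density mf).1 fi.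
pose g y := (`|f y| - f y)%R.
have mn : measurable_fun setT (fun y => `|f y|)%R by exact: measurableT_comp.
have mg : measurable_fun setT g by exact: measurable_funB.
have ni : nu.-integrable setT (EFin \o (fun y => `|f y|)%R).
  by apply: le_integrable fi => //; [exact/measurable_EFinP|move=> y _ /=; rewrite normr_id].
have gi : nu.-integrable setT (EFin \o g).
  by have := integrableB measurableT ni fi; apply: eq_integrable.
have g0 y : (0 <= g y)%R by rewrite subr_ge0 ler_norm.
have fE y : f y = (`|f y| - g y)%R by rewrite /g opprB addrC subrK.
have nWi := (integrable_density mn).1 ni.
have gWi := (integrable_density mg).1 gi.
transitivity (\int[nu]_y ((`|f y|)%:E - (g y)%:E)).
  by apply: eq_integral => y _; rewrite [in LHS]fE EFinB.
rewrite integralB_EFin// !ge0_integral_density// -integralB_EFin//.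
by apply: eq_integral => y _; rewrite -EFinB -mulrBl -fE.
Qed.

End Density.

Section GaussianMoments.
Context (R : realType) (s : R) (s_gt0 : 0 < s).
Notation mu := (@lebesgue_measure R).
Notation p := (@normal_pdf R 0 s).

Let s0 : s != 0. Proof. by rewrite gt_eqF. Qed.

Let pdfE (t x : R) : t != 0 ->
  normal_pdf 0 t x = normal_peak t * expR (- x ^+ 2 / (t ^+ 2 *+ 2)).
Proof. by move=> t0; rewrite normal_pdfE// /normal_fun subr0. Qed.

Let ge0_power_le_expR a (y : R) : 0 <= y -> y ^+ a <= (a%:R) ^+ a * expR y.
Proof.
case: a => [|a] y0; first by rewrite expr0 mul1r -expR0 ler_expR.
have a0 : 0 < a.+1%:R :> R by rewrite ltr0n.
have -> : y = a.+1%:R * (y / a.+1%:R) by rewrite mulrC divfK// gt_eqF.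
rewrite expRM_natl exprMn ler_pM2l ?exprn_gt0// lerXn2r ?nnegrE ?expR_ge0 ?divr_ge0 ?ler0n//.
by rewrite (le_trans _ (expR_ge1Dx _))// lerDr.
Qed.

(** Doubling the standard deviation absorbs any power of [x]; this yields both
    integrability and decay. *)
Let pdf_bound a : exists C, forall x, `|x ^+ a * p x| <= C * normal_pdf 0 (2 * s) x.
Proof.
(* K = 1 / (2 s^2) - 1 / (2 (2 s)^2), the gap between the two exponents *)
pose K := 3 / (s ^+ 2 * 8).
have ss : 0 < s ^+ 2 by rewrite exprn_gt0.
have K0 : 0 < K by rewrite divr_gt0// mulr_gt0.
pose D := 1 + a%:R ^+ a / K ^+ a.
have D1 : 0 <= D by rewrite addr_ge0// divr_ge0// exprn_ge0// ?ler0n// ltW.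
have bd x : `|x ^+ a| <= D * expR (K * x ^+ 2).
  have x2 : 0 <= x ^+ 2 := sqr_ge0 x.
  have e1 : 1 <= expR (K * x ^+ 2) by rewrite -expR0 ler_expR mulr_ge0// ltW.
  have h : `|x ^+ a| <= 1 + (x ^+ 2) ^+ a.
    rewrite -exprM mulnC exprM -[(x ^+ a) ^+ 2]real_normK ?num_real//.
    by have : 0 <= `|x ^+ a| by []; nra.
  apply: (le_trans h); rewrite mulrDl mul1r lerD// mulrAC ler_pdivlMr ?exprn_gt0//.
  by rewrite -exprMn [_ * K]mulrC ge0_power_le_expR// mulr_ge0// ltW.
have s20 : 2 * s != 0 by rewrite mulf_neq0.
have q0 : 0 < normal_peak (2 * s) by rewrite normal_peak_gt0.
exists (normal_peak s * D / normal_peak (2 * s)) => x.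
rewrite (pdfE x s20) (pdfE x s0) normrM.
rewrite [normal_peak (2 * s) * _]mulrC mulrA.
have -> : normal_peak s * D / normal_peak (2 * s) * 
    expR (- x ^+ 2 / ((2 * s) ^+ 2 *+ 2)) * normal_peak (2 * s) =
  normal_peak s * (D * expR (- x ^+ 2 / ((2 * s) ^+ 2 *+ 2))).
  by field; rewrite gt_eqF.
rewrite [X in _ * X]ger0_norm ?mulr_ge0 ?normal_peak_ge0 ?expR_ge0//.
rewrite mulrCA ler_wpM2l ?normal_peak_ge0//.
apply: (le_trans (ler_wpM2r (expR_ge0 _) (bd x))).
rewrite -mulrA ler_wpM2l// -expRD ler_expR.
rewrite (_ : _ + _ = - x ^+ 2 / ((2 * s) ^+ 2 *+ 2))//.
have -> : (2 * s) ^+ 2 *+ 2 = 8 * s ^+ 2 by ring.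
have -> : s ^+ 2 *+ 2 = 2 * s ^+ 2 by ring.
by rewrite /K; move: (s ^+ 2) (gt_eqF ss) => S /negbT S0; field.
Qed.

Let continuous_power_pdf a : continuous (fun x : R => x ^+ a * p x).
Proof.
move=> x; apply: (@continuousM _ _ (fun x : R => x ^+ a) p).
  exact: exprn_continuous.
exact: continuous_normal_pdf.
Qed.

Let measurable_power_pdf a : measurable_fun setT (fun x : R => x ^+ a * p x).
Proof. exact: continuous_measurable_fun. Qed.

Let integrable_power_pdf a : mu.-integrable setT (EFin \o (fun x : R => x ^+ a * p x)).
Proof.
have [C hC] := pdf_bound a.
have := integrableZl measurableT C (integrable_normal_pdf 0 (2 * s)).
apply: le_integrable => //.
  by apply: measurableT_comp => //; exact: measurable_power_pdf.
move=> x _ /=; rewrite lee_fin (le_trans (hC x))//.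
exact: ler_norm.
Qed.

Let pdf_deriv a (x : R) : R := a%:R * (x ^+ a.-1 * p x) - (s ^+ 2)^-1 * (x ^+ a.+1 * p x).

Let is_derive_power_pdf a (x : R) : is_derive x 1 (@id R ^+ a * p : R -> R) (pdf_deriv a x).
Proof.
have dp : is_derive x 1 p (- x / s ^+ 2 * p x).
  have s2 : s ^+ 2 *+ 2 = 2 * s ^+ 2 by ring.
  have dq : is_derive x 1 (fun x : R => - x ^+ 2 / (s ^+ 2 *+ 2)) (- x / s ^+ 2).
    rewrite s2.
    have -> : (fun x : R => - x ^+ 2 / (2 * s ^+ 2)) = (- (2 * s ^+ 2)^-1) \*o (@id R ^+ 2).
      by apply/funext => y /=; rewrite exprfctE mulNr mulrC mulNr.
    apply: is_derive_eq; rewrite /GRing.scale/=.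
    by field.
  have dc := is_derive1_comp (is_derive_expR _) dq.
  have -> : p = normal_peak s \*o (expR \o (fun x : R => - x ^+ 2 / (s ^+ 2 *+ 2))).
    by apply/funext => y; rewrite pdfE.
  by apply: is_derive_eq; rewrite /GRing.scale/=; ring.
apply: is_derive_eq; rewrite /pdf_deriv /GRing.scale/= (exprS x a) exprfctE.
by field.
Qed.

Let continuous_pdf_deriv a : continuous (pdf_deriv a).
Proof.
move=> x; apply: (@continuousB _ _ _ (fun x : R => a%:R * (x ^+ a.-1 * p x))
  (fun x : R => (s ^+ 2)^-1 * (x ^+ a.+1 * p x))).
- by apply: (@continuousM _ _ (cst a%:R) (fun x : R => x ^+ a.-1 * p x));
    [exact: cst_continuous|exact: continuous_power_pdf].
- by apply: (@continuousM _ _ (cst (s ^+ 2)^-1) (fun x : R => x ^+ a.+1 * p x));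
    [exact: cst_continuous|exact: continuous_power_pdf].
Qed.

Let integrable_scaled_power_pdf c a :
  mu.-integrable setT (EFin \o (fun x : R => c * (x ^+ a * p x))).
Proof.
have := integrableZl measurableT c (integrable_power_pdf a).
by apply: eq_integrable.
Qed.

Let integrable_pdf_deriv a : mu.-integrable setT (EFin \o pdf_deriv a).
Proof.
have := integrableB measurableT (integrable_scaled_power_pdf a%:R a.-1)
  (integrable_scaled_power_pdf (s ^+ 2)^-1 a.+1).
by apply: eq_integrable.
Qed.

Let cvg_integral_itv (h : R -> R) : mu.-integrable setT (EFin \o h) ->
  (fun n : nat => \int[mu]_(x in `[- n.+1%:R, n.+1%:R]) h x) @ \oo
    --> \int[mu]_x h x.
Proof.
move=> hi.
move/integrableP : (hi) => [mh _].
suff H : (fun n : nat => \int[mu]_(x in `[(- n.+1%:R)%R, n.+1%:R%R]) (h x)%:E)%E @ \oo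
    --> (\int[mu]_x (h x)%:E)%E.
  by apply: fine_cvg; rewrite fineK//; exact: integrable_fin_num.
under eq_fun do rewrite integral_mkcond.
apply: (@dominated_cvg _ _ _ mu _ measurableT _ _ (fun x : R => `|(h x)%:E|%E)) => //.
- move=> n; apply: (measurable_restrictT _ _).1 => //.
  exact: (measurable_funTS mh).
- move=> x _; apply: cvg_near_cst; near=> n.
  rewrite patchE ifT// inE/= in_itv/= -ler_norml.
  near: n; exists (Num.truncn `|x|) => //= n hn.
  by rewrite (le_trans (ltW (truncnS_gt _)))// ler_nat.
- exact: integrable_abse.
- by move=> n x _; rewrite patchE; case: ifP => // _; rewrite abse0 abse_ge0.
Unshelve. all: by end_near. Qed.

Let cvg_power_pdf a : (fun n : nat => (n.+1%:R : R) ^+ a * p n.+1%:R -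
   (- n.+1%:R) ^+ a * p (- n.+1%:R)) @ \oo --> (0 : R).
Proof.
have [C hC] := pdf_bound a.+1.
pose M := C * normal_peak (2 * s).
have s20 : 2 * s != 0 by rewrite mulf_neq0.
have bd x : `|x ^+ a.+1 * p x| <= M.
  apply: (le_trans (hC x)); rewrite ler_wpM2l//; last exact: normal_pdf_ub.
  have := le_trans (normr_ge0 _) (hC 0); rewrite pmulr_lge0//.
  by rewrite pdfE// mulr_gt0 ?normal_peak_gt0 ?expR_gt0.
have bd' (n : nat) x : `|x| = n.+1%:R -> `|x ^+ a * p x| <= M / n.+1%:R.
  move=> xn; rewrite ler_pdivlMr ?ltr0n// -xn mulrC -normrM mulrA -exprS.
  exact: bd.
apply/norm_cvg0P.
apply: (@squeeze_cvgr _ _ _ _ (cst 0) (fun n => 2 * M * (@harmonic R) n)).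
- near=> n; rewrite normr_ge0/= (le_trans (ler_normB _ _))// /harmonic/=.
  by rewrite -mulrA mulr2n mulrDl mul1r lerD//; apply: bd'; rewrite ?normrN normr_nat.
- exact: cvg_cst.
- rewrite -[X in _ --> X](mulr0 (2 * M)); apply: cvgMr; exact: cvg_harmonic.
Unshelve. all: by end_near. Qed.

Let integral_pdf_deriv a : \int[mu]_x pdf_deriv a x = 0.
Proof.
have h := cvg_integral_itv (integrable_pdf_deriv a).
apply/esym/(cvg_unique _ _ h) => //.
have -> : (fun n : nat => \int[mu]_(x in `[- n.+1%:R, n.+1%:R]) pdf_deriv a x) =
  (fun n : nat => (n.+1%:R : R) ^+ a * p n.+1%:R - (- n.+1%:R) ^+ a * p (- n.+1%:R)).
  apply/funext => n; rewrite /Rintegral (@continuous_FTC2 _ _ (@id R ^+ a * p))//.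
  - by rewrite /= !fctE.
  - by apply: gtrN; rewrite ltr0n.
  - exact/continuous_subspaceT/continuous_pdf_deriv.
  - have cG : continuous (@id R ^+ a * p).
      move=> x; apply: differentiable_continuous; apply/derivable1_diffP.
      by case: (is_derive_power_pdf a x).
    split.
    + by move=> x _; case: (is_derive_power_pdf a x).
    + by apply: cvg_at_right_filter; exact: cG.
    + by apply: cvg_at_left_filter; exact: cG.
  - move=> x _; have d := is_derive_power_pdf a x.
    by rewrite derive1E derive_val.
exact: cvg_power_pdf.
Qed.

Definition gaussian_moment a : R := \int[normal_prob 0 s]_x (x ^+ a).

Let density A : measurable A ->
  normal_prob 0 s A = (\int[mu]_(x in id @^-1` A) (p x)%:E)%E.
Proof. by []. Qed.

Let mpow a : measurable_fun setT (fun x : R => x ^+ a).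
Proof. exact: exprn_measurable. Qed.

Lemma integrable_gaussian_power a :
  (normal_prob 0 s).-integrable setT (EFin \o (fun x : R => x ^+ a)).
Proof.
have -> := @integrable_density _ _ _ _ R mu (normal_prob 0 s) id p
  (@measurable_id _ _ _) (measurable_normal_pdf 0 s) (normal_pdf_ge0 0 s) density
  _ (mpow a).
exact: integrable_power_pdf.
Qed.

Let gaussian_momentE a : gaussian_moment a = \int[mu]_x (x ^+ a * p x).
Proof.
rewrite /gaussian_moment /Rintegral; congr fine.
exact: (@integral_density _ _ _ _ R mu (normal_prob 0 s) id p
  (@measurable_id _ _ _) (measurable_normal_pdf 0 s) (normal_pdf_ge0 0 s) density
  _ (mpow a) (integrable_gaussian_power a)).
Qed.

Lemma gaussian_moment0 : gaussian_moment 0 = 1.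
Proof.
rewrite gaussian_momentE /Rintegral; under eq_integral do rewrite expr0 mul1r.
by rewrite integral_normal_pdf.
Qed.

(** The derivative of [x ^ a] times the density has integral 0. *)
Lemma gaussian_momentS a : gaussian_moment a.+1 = s ^+ 2 * (a%:R * gaussian_moment a.-1).
Proof.
have := integral_pdf_deriv a.
rewrite /pdf_deriv RintegralB// !RintegralZl// -!gaussian_momentE.
move=> /eqP; rewrite subr_eq0 => /eqP ->.
by rewrite mulrA mulfV ?mul1r// sqrf_eq0.
Qed.

End GaussianMoments.

(** * Expectations of products of independent variables *)

Section Independence.
Context d (T : measurableType d) (R : realType) (P : probability T R).
Context (I : finType) (D : {set I}) (xi : I -> {RV P >-> R}).
Hypothesis indep : forall (J : {set I}) (A : I -> set R), J \subset D ->
  (forall i, measurable (A i)) ->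
  P (\bigcap_(i in [set` J]) (xi i @^-1` A i)) = (\prod_(i in J) P (xi i @^-1` A i))%E.
Implicit Types (J : {set I}) (phi : I -> R -> R).

Let upd phi i g : I -> R -> R := fun j => if j == i then g else phi j.

Let upd_prod J phi i g w : i \in J ->
  \prod_(j in J) upd phi i g j (xi j w)
  = g (xi i w) * \prod_(j in J | j != i) phi j (xi j w).
Proof.
move=> iJ; rewrite (bigD1 i)//= /upd eqxx; congr (_ * _).
by apply: eq_bigr => j /andP[_ /negPf ->].
Qed.

Let upd_measurable phi i g : (forall j, measurable_fun setT (phi j)) ->
  measurable_fun setT g -> forall j, measurable_fun setT (upd phi i g j).
Proof. by move=> mphi mg j; rewrite /upd; case: ifP. Qed.

Let measurable_factor phi i : (forall i, measurable_fun setT (phi i)) ->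
  measurable_fun setT (fun w => phi i (xi i w)).
Proof. by move=> mphi; apply: measurableT_comp. Qed.

Let measurable_product J (Q : pred I) phi : (forall i, measurable_fun setT (phi i)) ->
  measurable_fun setT (fun w => \prod_(j in J | Q j) phi j (xi j w)).
Proof.
move=> mphi; under eq_fun do rewrite -big_filter.
by apply: measurable_prod => j _; exact: measurable_factor.
Qed.

Let integrable_factor phi i := P.-integrable setT (fun w => (phi i (xi i w))%:E).

Let integrable_indic_factor A i : measurable A ->
  P.-integrable setT (fun w => (\1_A (xi i w) : R)%:E).
Proof.
move=> mA; apply: (eq_integrable measurableT (fun w => (\1_(xi i @^-1` A) w : R)%:E)) => //.
by apply: integrable_indic; apply: measurable_funPTI.
Qed.

Let Rintegral_indic_factor A i : measurable A ->
  \int[P]_w \1_A (xi i w) = fine (P (xi i @^-1` A)).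
Proof.
move=> mA; rewrite /Rintegral -[X in P X]setIT -integral_indic//.
by apply: measurable_funPTI.
Qed.

Let integrable_Rintegral (f : T -> R) : P.-integrable setT (EFin \o f) ->
  (\int[P]_w (f w)%:E)%E = (\int[P]_w f w)%:E.
Proof. by move=> fi; rewrite fineK//; exact: integrable_fin_num. Qed.

(** Indicators are upgraded to nonnegative functions one index at a time: with
    all other factors fixed, both sides are measures in the set selected by the
    remaining indicator, so they integrate every nonnegative function alike. *)
Let ge0_expectation_prod J (l : seq I) phi : J \subset D ->
  (forall i, measurable_fun setT (phi i)) ->
  (forall i x, 0 <= phi i x) ->
  (forall i, i \in J -> integrable_factor phi i) ->
  (forall i, i \in J -> i \notin l -> exists2 A, measurable A & phi i = \1_A) ->
  (\int[P]_w (\prod_(i in J) phi i (xi i w))%:E)%E =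
  (\prod_(i in J) \int[P]_w phi i (xi i w))%:E.
Proof.
move=> JD; elim: l phi => [|i l IH] phi mphi phi0 iphi ind.
  have /choice[A hA] : forall i, exists B : set R,
      measurable B /\ (i \in J -> phi i = \1_B).
    move=> i.
    have [iJ|iJ] := boolP (i \in J); last by exists set0; split.
    by have [B mB ->] := ind i iJ isT; exists B.
  transitivity (P (\bigcap_(i in [set` J]) (xi i @^-1` A i))).
    rewrite -[X in P X]setIT -integral_indic//; last first.
      apply: fin_bigcap_measurable => // j _; apply: measurable_funPTI.
      by case: (hA j).
    apply: eq_integral => w _; congr EFin; rewrite indicE.
    have [/mem_set wA|wA] := boolP (w \in _).
      rewrite big1// => j jJ; rewrite (hA j).2// indicE.
      by rewrite mem_set//; move: wA; rewrite !inE => /(_ j jJ).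
    have [j jJ wj] : exists2 j, j \in J & ~ A j (xi j w).
      apply/not_exists2P => h; move/negP: wA; apply; rewrite inE => j /= jJ.
      by have [//|/contrapT] := h j.
    rewrite (bigD1 j)//= (hA j).2// indicE memNset// mul0r//.
  rewrite indep//; last by move=> j; case: (hA j).
  rewrite -prodEFin; apply: eq_bigr => j jJ.
  have [mA pA] := hA j.
  rewrite pA// Rintegral_indic_factor// fineK//.
  by apply: fin_num_measure; apply: measurable_funPTI.
have [iJ|iJ] := boolP (i \in J); last first.
  apply: IH => // j jJ jl; apply: ind => //.
  by rewrite inE negb_or jl andbT; apply: contraNneq iJ => <-.
pose W w := \prod_(j in J | j != i) phi j (xi j w).
pose Z := \prod_(j in J | j != i) \int[P]_w phi j (xi j w).
have W0 w : 0 <= W w by apply: prodr_ge0.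
have Z0 : 0 <= Z.
  by apply: prodr_ge0 => j _; apply: Rintegral_ge0.
have mW : measurable_fun setT W by exact: measurable_product.
have -> : \prod_(j in J) \int[P]_w phi j (xi j w) = \int[P]_w phi i (xi i w) * Z.
  by rewrite (bigD1 i).
transitivity (\int[P]_w (phi i (xi i w) * W w)%:E)%E.
  by apply: eq_integral => w _; rewrite (bigD1 i).
pose nu := mscale (NngNum Z0) (distribution P (xi i)).
have nuE A : measurable A ->
    nu A = (\int[P]_(w in xi i @^-1` A) (W w)%:E)%E.
  move=> mA.
  have mpA : measurable (xi i @^-1` A) by apply: measurable_funPTI.
  have := IH (upd phi i \1_A).
  under eq_integral do rewrite upd_prod//.
  have -> : \prod_(j in J) \int[P]_w upd phi i \1_A j (xi j w) =
      Z * fine (P (xi i @^-1` A)).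
    rewrite (bigD1 i)//= /upd eqxx Rintegral_indic_factor// mulrC; congr (_ * _).
    by apply: eq_bigr => j /andP[_ /negPf ->].
  move=> h; transitivity (Z%:E * P (xi i @^-1` A))%E; first by [].
  rewrite -[P _]fineK ?fin_num_measure// -EFinM -h.
  - rewrite [RHS]integral_mkcond; apply: eq_integral => w _.
    rewrite epatch_indic /= muleC -EFinM; congr (_ * _)%:E.
  - by apply: upd_measurable => //; exact: measurable_indic.
  - by move=> j x; rewrite /upd; case: ifP.
  - move=> j jJ; rewrite /integrable_factor /upd.
    by case: ifP => [/eqP ->|_]; [exact: integrable_indic_factor|exact: iphi].
  - move=> j jJ jl; rewrite /upd; case: eqP => [_|/eqP ji]; first by exists A.
    by apply: ind => //; rewrite inE negb_or ji jl.
rewrite -(@ge0_integral_density _ _ _ _ R P nu (xi i) W _ mW W0 nuE)//.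
rewrite ge0_integral_mscale//; last 2 first.
- by apply/measurable_EFinP.
- by move=> x _; rewrite lee_fin.
rewrite ge0_integral_distribution//; last 2 first.
- by apply/measurable_EFinP.
- by move=> x; rewrite lee_fin.
rewrite mulrC EFinM; congr (_ * _)%E.
by rewrite -integrable_Rintegral//; exact: iphi.
Qed.

(** Signs are handled one index at a time as well, by [x = |x| - (|x| - x)]. *)
Let expectation_prod_seq J (l : seq I) phi : J \subset D ->
  (forall i, measurable_fun setT (phi i)) ->
  (forall i, i \in J -> integrable_factor phi i) ->
  (forall i, i \notin l -> forall x, 0 <= phi i x) ->
  P.-integrable setT (fun w => (\prod_(i in J) phi i (xi i w))%:E) /\
  \int[P]_w (\prod_(i in J) phi i (xi i w)) =
  \prod_(i in J) \int[P]_w phi i (xi i w).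
Proof.
move=> JD; elim: l phi => [|i l IH] phi mphi iphi pos.
  have E : (\int[P]_w (\prod_(i in J) phi i (xi i w))%:E)%E =
      (\prod_(i in J) \int[P]_w phi i (xi i w))%:E.
    apply: (@ge0_expectation_prod J (enum I)) => // i; first exact: pos.
    by rewrite mem_enum.
  split; last by rewrite /Rintegral E.
  apply/integrableP; split.
    apply/measurable_EFinP; have := measurable_product J xpredT mphi.
    by apply: eq_measurable_fun => w _; apply: eq_bigl => j; rewrite andbT.
  under eq_integral.
    move=> w _; rewrite gee0_abs; last by rewrite lee_fin prodr_ge0// => j _; exact: pos.
    over.
  by rewrite E ltry.
have [iJ|iJ] := boolP (i \in J); last first.
  have {}E := IH (upd phi i (cst 0)).
  have [|||E1 E2] := E.
  - by apply: upd_measurable => //; exact: measurable_cst.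
  - move=> j jJ; rewrite /integrable_factor /upd; case: eqP => [ji|_]; last exact: iphi.
    by move: jJ; rewrite ji (negPf iJ).
  - by move=> j jl x; rewrite /upd; case: eqP => // /eqP ji; apply: pos; rewrite inE negb_or ji.
  have pE w : \prod_(j in J) upd phi i (cst 0) j (xi j w) = \prod_(j in J) phi j (xi j w).
    apply: eq_bigr => j jJ; rewrite /upd; case: eqP => // ji.
    by move: jJ; rewrite ji (negPf iJ).
  split; first by move: E1; under eq_fun do rewrite pE.
  move: E2; under eq_Rintegral do rewrite pE.
  move=> ->; apply: eq_bigr => j jJ; rewrite /upd; case: eqP => // ji.
  by move: jJ; rewrite ji (negPf iJ).
pose f x : R := `|phi i x|.
pose g x : R := `|phi i x| - phi i x.
have mf : measurable_fun setT f by exact: measurableT_comp.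
have mg : measurable_fun setT g by exact: measurable_funB.
have f0 x : 0 <= f x by exact: normr_ge0.
have g0 x : 0 <= g x by rewrite subr_ge0 ler_norm.
have fi : P.-integrable setT (fun w => (f (xi i w))%:E).
  have := integrable_abse (iphi i iJ).
  by apply: eq_integrable.
have gi : P.-integrable setT (fun w => (g (xi i w))%:E).
  have := integrableB measurableT fi (iphi i iJ).
  by apply: eq_integrable.
have phiE x : phi i x = f x - g x by rewrite /g opprB addrC subrK.
have step (h : R -> R) : measurable_fun setT h -> (forall x, 0 <= h x) ->
    P.-integrable setT (fun w => (h (xi i w))%:E) ->
    P.-integrable setT (fun w => (\prod_(j in J) upd phi i h j (xi j w))%:E) /\
    \int[P]_w (\prod_(j in J) upd phi i h j (xi j w)) =
    \int[P]_w h (xi i w) * \prod_(j in J | j != i) \int[P]_w phi j (xi j w).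
  move=> mh h0 hi; have [|||E1 E2] := IH (upd phi i h).
  - exact: upd_measurable.
  - move=> j jJ; rewrite /integrable_factor /upd; case: eqP => [->//|_]; exact: iphi.
  - by move=> j jl x; rewrite /upd; case: eqP => // /eqP ji; apply: pos; rewrite inE negb_or ji.
  split=> //; rewrite E2 (bigD1 i)//= {1}/upd eqxx; congr (_ * _).
  by apply: eq_bigr => j /andP[_ /negPf ji]; rewrite /upd ji.
have [f1 f2] := step f mf f0 fi; have [g1 g2] := step g mg g0 gi.
have pE w : \prod_(j in J) phi j (xi j w) =
  \prod_(j in J) upd phi i f j (xi j w) - \prod_(j in J) upd phi i g j (xi j w).
  by rewrite !upd_prod// -mulrBl -phiE (bigD1 i).
split.
  have := integrableB measurableT f1 g1.
  by apply: eq_integrable => // w _; rewrite pE EFinB.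
under eq_Rintegral do rewrite pE.
rewrite RintegralB// f2 g2 -mulrBl -RintegralB//.
by rewrite [RHS](bigD1 i)//=; under [in RHS]eq_Rintegral do rewrite phiE.
Qed.

Lemma expectation_prod J phi : J \subset D ->
  (forall i, measurable_fun setT (phi i)) ->
  (forall i, i \in J -> P.-integrable setT (fun w => (phi i (xi i w))%:E)) ->
  P.-integrable setT (fun w => (\prod_(i in J) phi i (xi i w))%:E) /\
  \int[P]_w (\prod_(i in J) phi i (xi i w)) =
  \prod_(i in J) \int[P]_w phi i (xi i w).
Proof.
move=> JD mphi iphi; apply: (@expectation_prod_seq J (enum I)) => // i.
by rewrite mem_enum.
Qed.

End Independence.

(** * Expectations of polynomials in Gaussian variables *)

Section PolynomialExpectation.
Local Open Scope complex_scope.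
Context d (T : measurableType d) (R : realType) (P : probability T R).
Variables (N : nat) (x : 'I_N -> T -> R) (mom : 'I_N -> nat -> R) (var : 'I_N -> R).
Hypothesis monomial_integrable : forall m : 'I_N -> nat,
  P.-integrable setT (fun w => (\prod_v x v w ^+ m v)%:E).
Hypothesis monomial_expectation : forall m : 'I_N -> nat,
  \int[P]_w (\prod_v x v w ^+ m v) = \prod_v mom v (m v).
Hypothesis mom_rec : forall v k, mom v k.+1 = var v * (k%:R * mom v k.-1).

Notation K := (mpoly N R[i]).

Definition poly_value (w : T) (p : K) : R[i] := meval (fun v => (x v w)%:C) p.

(** Kept as an expectation of values rather than as a functional on coefficients,
    so that it directly computes the moments of the random matrix. *)
Definition poly_expectation (p : K) : R[i] :=
  (\int[P]_w complex.Re (poly_value w p)) +i* (\int[P]_w complex.Im (poly_value w p)).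

Let poly_valueD w p q : poly_value w (p + q) = poly_value w p + poly_value w q.
Proof. exact: mevalD. Qed.

Let poly_valueZ w c p : poly_value w (c *: p) = c * poly_value w p.
Proof. exact: mevalZ. Qed.

Let poly_valueX w m : poly_value w (mpolyX R[i] m) = (\prod_v x v w ^+ m v)%:C.
Proof.
rewrite /poly_value mevalX rmorph_prod.
by apply: eq_bigr => v _; rewrite rmorphXn.
Qed.

Let ReD (a b : R[i]) : complex.Re (a + b) = complex.Re a + complex.Re b.
Proof. by case: a b => [? ?] []. Qed.
Let ImD (a b : R[i]) : complex.Im (a + b) = complex.Im a + complex.Im b.
Proof. by case: a b => [? ?] []. Qed.
Let ReM (a b : R[i]) : complex.Re (a * b) =
  complex.Re a * complex.Re b - complex.Im a * complex.Im b.
Proof. by case: a b => [? ?] []. Qed.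
Let ImM (a b : R[i]) : complex.Im (a * b) =
  complex.Re a * complex.Im b + complex.Im a * complex.Re b.
Proof. by case: a b => [? ?] []. Qed.

Let integrableZ (c : R) (f : T -> R) : P.-integrable setT (EFin \o f) ->
  P.-integrable setT (EFin \o (fun w => c * f w)).
Proof.
by move=> fi; have := integrableZl measurableT c fi; apply: eq_integrable.
Qed.

Let integrableDR (f g : T -> R) : P.-integrable setT (EFin \o f) ->
  P.-integrable setT (EFin \o g) -> P.-integrable setT (EFin \o (fun w => f w + g w)).
Proof.
by move=> fi gi; have := integrableD measurableT fi gi; apply: eq_integrable.
Qed.

Lemma integrable_poly_value p :
  P.-integrable setT (EFin \o (fun w => complex.Re (poly_value w p))) /\
  P.-integrable setT (EFin \o (fun w => complex.Im (poly_value w p))).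
Proof.
elim/mpolyind: p => [|c m p _ _ [IHr IHi]].
  split; apply: (eq_integrable measurableT (cst 0)) => //; try exact: integrable0;
  by move=> w _; rewrite /= /poly_value meval0.
split.
- apply: (eq_integrable measurableT (EFin \o (fun w =>
    complex.Re c * (\prod_v x v w ^+ m v) + complex.Re (poly_value w p)))).
    by move=> w _ /=; rewrite poly_valueD poly_valueZ poly_valueX ReD ReM /= mulr0 subr0.
  by apply: integrableDR => //; exact: (integrableZ _ (monomial_integrable _)).
- apply: (eq_integrable measurableT (EFin \o (fun w =>
    complex.Im c * (\prod_v x v w ^+ m v) + complex.Im (poly_value w p)))).
    by move=> w _ /=; rewrite poly_valueD poly_valueZ poly_valueX ImD ImM /= mulr0 add0r.
  by apply: integrableDR => //; exact: (integrableZ _ (monomial_integrable _)).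
Qed.

Let integrable_Re p : P.-integrable setT (EFin \o (fun w => complex.Re (poly_value w p))).
Proof. by case: (integrable_poly_value p). Qed.
Let integrable_Im p : P.-integrable setT (EFin \o (fun w => complex.Im (poly_value w p))).
Proof. by case: (integrable_poly_value p). Qed.

Lemma poly_expectationD p q :
  poly_expectation (p + q) = poly_expectation p + poly_expectation q.
Proof.
rewrite /poly_expectation.
under eq_Rintegral do rewrite poly_valueD ReD.
under [X in _ +i* X = _]eq_Rintegral do rewrite poly_valueD ImD.
by rewrite !RintegralD.
Qed.

Lemma poly_expectationZ c p : poly_expectation (c *: p) = c * poly_expectation p.
Proof.
rewrite /poly_expectation.
under eq_Rintegral do rewrite poly_valueZ ReM.
under [X in _ +i* X = _]eq_Rintegral do rewrite poly_valueZ ImM.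
rewrite RintegralB ?RintegralD ?RintegralZl//; try exact: integrableZ.
by case: c.
Qed.

Let poly_expectation0 : poly_expectation 0 = 0.
Proof. by rewrite -[0 in LHS](scale0r (0 : K)) poly_expectationZ mul0r. Qed.

Lemma poly_expectation_is_zmod_morphism : zmod_morphism poly_expectation.
Proof.
move=> p q; rewrite poly_expectationD -scaleN1r poly_expectationZ mulN1r.
by [].
Qed.

Lemma poly_expectationX m :
  poly_expectation (mpolyX R[i] m) = (\prod_v mom v (m v))%:C.
Proof.
rewrite /poly_expectation.
under eq_Rintegral do rewrite poly_valueX /=.
under [X in _ +i* X = _]eq_Rintegral do rewrite poly_valueX /=.
by rewrite monomial_expectation Rintegral_cst// mul0r.
Qed.

(** On monomials this is the recurrence of the one-dimensional moments. *)
Lemma poly_expectation_parts v p :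
  poly_expectation (mpolyX R[i] (mnm1 v) * p) =
  (var v)%:C * poly_expectation (mderiv v p).
Proof.
elim/mpolyind: p => [|c m p _ _ IH]; first by rewrite mulr0 mderiv0 poly_expectation0 mulr0.
rewrite mulrDr mderivD !poly_expectationD mulrDr IH; congr (_ + _).
rewrite -scalerAr -mpolyXD mderivZ mderivX !poly_expectationZ !poly_expectationX.
rewrite mulrCA; congr (c * _).
rewrite (bigD1 v)//= [in RHS](bigD1 v)//= mnmDE mnmBE mnm1E eqxx add1n subn1.
rewrite mom_rec -[in RHS](rmorph_nat (real_complex R)) -!rmorphM; congr (_%:C).
rewrite -!mulrA; congr (_ * (_ * (_ * _))); apply: eq_bigr => u uv.
by rewrite mnmDE mnmBE mnm1E eq_sym (negPf uv) add0n subn0.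
Qed.

End PolynomialExpectation.

(** * The Hermitian matrix of Gaussian polynomials *)

Section HermitianPolynomialMatrix.
Local Open Scope complex_scope.
Variables (R : realType) (n : nat).
Notation I := (bool * ('I_n * 'I_n))%type.
Notation K := (mpoly #|{: I}| R[i]).

Let r : R[i] := ((Num.sqrt 2)^-1)%:C.

Let r2 : r * r = 2^-1.
Proof.
rewrite -rmorphM -expr2 exprVn sqr_sqrtr// fmorphV.
by rewrite rmorph_nat.
Qed.

(** The coefficient of each driving variable in the matrix entry [(a, b)]: the
    index [(false, (j, l))] stands for the real part and [(true, (j, l))] for the
    imaginary part of the entry [(j, l)] above the diagonal. *)
Definition entry_coef (a b : 'I_n) (i : I) : R[i] :=
  if a == b then (~~ i.1 && (i.2 == (a, a)))%:R
  else if (a < b)%N then (i.2 == (a, b))%:R * (if i.1 then 'i * r else r)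
  else (i.2 == (b, a))%:R * (if i.1 then - ('i * r) else r).

Lemma sum_at_pair (F : bool -> R[i]) (G : I -> R[i]) (q : 'I_n * 'I_n) :
  \sum_(i : I) (i.2 == q)%:R * F i.1 * G i = F true * G (true, q) + F false * G (false, q).
Proof.
transitivity (\sum_e \sum_p (p == q)%:R * F e * G (e, p)).
  by rewrite pair_bigA; apply: eq_bigr => -[e p].
rewrite big_bool.
by congr (_ + _); rewrite (bigD1 q)//= eqxx mul1r big1 ?addr0// => p /negPf ->; rewrite !mul0r.
Qed.

(** The real and imaginary parts contribute [1/2 - 1/2] when the entries coincide
    and [1/2 + 1/2] when they are conjugate, so each entry is only correlated
    with its conjugate. *)
Lemma entry_coef_orthogonal a b c d :
  \sum_i entry_coef a b i * entry_coef c d i = (c == b)%:R * (a == d)%:R.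
Proof.
have i2 : 'i * 'i = -1 :> R[i] by rewrite -expr2 sqr_i.
have [<-{b}|ab] := eqVneq a b.
  have -> : \sum_i entry_coef a a i * entry_coef c d i =
      \sum_(i : I) (i.2 == (a, a))%:R * (~~ i.1)%:R * entry_coef c d i.
    apply: eq_bigr => i _; congr (_ * _).
    by rewrite /entry_coef eqxx mulrC -natrM mulnb.
  rewrite (sum_at_pair (fun e => (~~ e)%:R)) /= mul0r add0r mul1r /entry_coef /=.
  have [<-|cd] := eqVneq c d.
    by rewrite xpair_eqE andbb -natrM mulnb [a == c]eq_sym andbb.
  have -> : ((a, a) == (c, d)) = false.
    by apply/negP => /eqP[ac ad]; move: cd; rewrite -ac -ad eqxx.
  have -> : ((a, a) == (d, c)) = false.
    by apply/negP => /eqP[ac ad]; move: cd; rewrite -ac -ad eqxx.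
  rewrite !mul0r if_same -natrM mulnb [c == a]eq_sym; case: eqP => // ac.
  by case: eqP => // ad; move: cd; rewrite -ac -ad eqxx.
have rr : r * r + r * r = 1 by rewrite r2 [RHS]splitr mul1r.
have irir : ('i * r) * ('i * r) = - (r * r) by rewrite mulrACA i2 mulN1r.
have off e : entry_coef c c (e, (a, b)) = 0.
  rewrite /entry_coef eqxx /= xpair_eqE; case: eqP => [<-|_]; last by rewrite andbF.
  by rewrite eq_sym (negPf ab) !andbF.
have off' e : entry_coef c c (e, (b, a)) = 0.
  rewrite /entry_coef eqxx /= xpair_eqE; case: eqP => [<-|_]; last by rewrite andbF.
  by rewrite (negPf ab) !andbF.
have [altb|blta|/val_inj abE] := ltngtP a b; last by rewrite abE eqxx in ab.
- have -> : \sum_i entry_coef a b i * entry_coef c d i =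
      \sum_(i : I) (i.2 == (a, b))%:R * (if i.1 then 'i * r else r) * entry_coef c d i.
    by apply: eq_bigr => i _; rewrite {1}/entry_coef (negPf ab) altb.
  rewrite (sum_at_pair (fun e => if e then 'i * r else r)).
  have [<-|cd] := eqVneq c d.
    rewrite !off !mulr0 addr0; case: eqP => [->|_]; last by rewrite mul0r.
    by rewrite (negPf ab) mulr0.
  rewrite /entry_coef (negPf cd) /=; case: ltnP => [cltd|dlec].
    rewrite 2!(mulrCA _ (_ == _)%:R) -mulrDr irir addNr mulr0.
    have [cb|] := eqVneq c b; last by rewrite mul0r.
    have [ad|] := eqVneq a d; last by rewrite mulr0.
    by move: cltd; rewrite cb -ad ltnNge (ltnW altb).
  rewrite 2!(mulrCA _ (_ == _)%:R) -mulrDr mulrN irir opprK rr mulr1.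
  by rewrite xpair_eqE -natrM mulnb andbC [b == c]eq_sym.
- have -> : \sum_i entry_coef a b i * entry_coef c d i =
      \sum_(i : I) (i.2 == (b, a))%:R * (if i.1 then - ('i * r) else r) * entry_coef c d i.
    by apply: eq_bigr => i _; rewrite {1}/entry_coef (negPf ab) ltnNge (ltnW blta).
  rewrite (sum_at_pair (fun e => if e then - ('i * r) else r)).
  have [<-|cd] := eqVneq c d.
    rewrite !off' !mulr0 addr0; case: eqP => [->|_]; last by rewrite mul0r.
    by rewrite (negPf ab) mulr0.
  rewrite /entry_coef (negPf cd) /=; case: ltnP => [cltd|dlec].
    rewrite 2!(mulrCA _ (_ == _)%:R) -mulrDr mulNr irir opprK rr mulr1.
    by rewrite xpair_eqE -natrM mulnb [b == c]eq_sym.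
  rewrite 2!(mulrCA _ (_ == _)%:R) -mulrDr mulrNN irir addNr mulr0.
  have [cb|] := eqVneq c b; last by rewrite mul0r.
  have [ad|] := eqVneq a d; last by rewrite mulr0.
  by move: dlec; rewrite cb -ad leqNgt blta.
Qed.

Definition hermitian_poly_mx : 'M[K]_n :=
  \matrix_(a, b) \sum_(i : I) entry_coef a b i *: mpolyX R[i] (mnm1 (enum_rank i)).

(** The derivation that Gaussian integration by parts attaches to the entry
    [(a, b)]; it is the partial derivative along the conjugate entry [(b, a)]. *)
Definition entry_deriv (a b : 'I_n) (p : K) : K :=
  \sum_(i : I) entry_coef a b i *: mderiv (enum_rank i) p.

Lemma entry_deriv_is_zmod_morphism a b : zmod_morphism (entry_deriv a b).
Proof.
move=> p q; rewrite /entry_deriv -sumrB; apply: eq_bigr => i _.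
by rewrite mderivB scalerBr.
Qed.

HB.instance Definition _ a b := GRing.isZmodMorphism.Build K K (entry_deriv a b)
  (entry_deriv_is_zmod_morphism a b).

Lemma entry_derivM a b p q :
  entry_deriv a b (p * q) = entry_deriv a b p * q + p * entry_deriv a b q.
Proof.
rewrite /entry_deriv mulr_suml mulr_sumr -big_split; apply: eq_bigr => i _ /=.
by rewrite mderivM scalerDr scalerAl; congr (_ + _); rewrite scalerAr.
Qed.

Let mderiv_var (u v : 'I_#|{: I}|) : mderiv u (mpolyX R[i] (mnm1 v)) = (u == v)%:R.
Proof.
rewrite mderivX mnm1E eq_sym; have [->|_] := eqVneq u v; last by rewrite scale0r.
rewrite scale1r (_ : mnm_sub _ _ = mnm0) ?mpolyX0//.
by apply/mnmP => l; rewrite mnmBE subnn mnm0E.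
Qed.

Lemma entry_deriv_entry a b c d :
  entry_deriv a b (hermitian_poly_mx c d) = (c == b)%:R * (a == d)%:R.
Proof.
transitivity ((\sum_i entry_coef a b i * entry_coef c d i) *: (1 : K)); last first.
  by rewrite entry_coef_orthogonal -natrM scaler_nat -natrM.
rewrite scaler_suml /entry_deriv; apply: eq_bigr => i _.
suff -> : mderiv (enum_rank i) (hermitian_poly_mx c d) = entry_coef c d i *: 1.
  by rewrite scalerA.
rewrite mxE (big_morph _ (mderivD (enum_rank i)) (mderiv0 R[i] (enum_rank i))).
transitivity (\sum_(j : I) (entry_coef c d j * (i == j)%:R) *: (1 : K)).
  apply: eq_bigr => j _.
  by rewrite mderivZ mderiv_var (inj_eq enum_rank_inj) -[RHS]scalerA scaler_nat.
rewrite (bigD1 i)//= eqxx mulr1 big1 ?addr0// => j ji.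
by rewrite eq_sym (negPf ji) mulr0 scale0r.
Qed.

End HermitianPolynomialMatrix.

(** * Moments of the Hermitian Brownian motion *)

Section HermitianBrownianMoments.
Local Open Scope complex_scope.
Context d (T : measurableType d) (R : realType) (P : probability T R) (n : nat).
Variables (B beta : 'I_n -> 'I_n -> R -> {RV P >-> R}) (t : R).
Hypothesis t_gt0 : 0 < t.
Hypothesis BM : independent_brownian_motions B beta.
Notation I := (bool * ('I_n * 'I_n))%type.
Notation D := (driving_index n).
Notation K := (mpoly #|{: I}| R[i]).

Let xi (i : I) : {RV P >-> R} := driving_process B beta i t.

Let sqrt_t_gt0 : 0 < Num.sqrt t. Proof. by rewrite sqrtr_gt0. Qed.

(** The increments of a Brownian motion determine the law at time [t] only
    because it starts from 0 almost surely. *)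
Let brownian_marginal i A : i \in D -> measurable A ->
  normal_prob 0 (Num.sqrt t) A = (\int[P]_(w in xi i @^-1` A) (1 : R)%:E)%E.
Proof.
move=> iD mA; have [B0 _ Binc _] := BM.1 i iD.
have mxi s : measurable (driving_process B beta i s @^-1` A).
  by apply: measurable_funPTI.
have mdiff : measurable ((fun w => driving_process B beta i t w -
    driving_process B beta i 0 w) @^-1` A).
  by rewrite -[X in measurable X]setTI; apply: measurable_funB.
have := Binc 0 t (lexx 0) t_gt0 A mA; rewrite subr0 => <-.
rewrite integral_cst ?mul1e//; last exact: mxi.
rewrite -[X in P X = _]setIT -[X in _ = P X]setIT -!integral_indic//; last exact: mxi.
apply: ae_eq_integral => //.
- by apply/measurable_EFinP; exact: measurable_indic.
- by apply/measurable_EFinP; apply: measurable_indic; exact: mxi.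
apply: filterS B0 => w Bw _ /=.
congr EFin; rewrite !indicE.
suff -> : (w \in (fun w => driving_process B beta i t w - driving_process B beta i 0 w)
    @^-1` A) = (w \in xi i @^-1` A) by [].
by apply/idP/idP; rewrite !inE /= Bw subr0.
Qed.

Let mpow a : measurable_fun setT (fun y : R => y ^+ a).
Proof. exact: exprn_measurable. Qed.

Let integrable_marginal_power i a : i \in D ->
  P.-integrable setT (fun w => (xi i w ^+ a)%:E).
Proof.
move=> iD.
have mxi : measurable_fun setT (xi i) by [].
have := (@integrable_density _ _ _ _ R P (normal_prob 0 (Num.sqrt t)) (xi i)
  (cst 1) mxi (measurable_cst _) (fun=> ler01)
  (fun A => brownian_marginal iD) _ (mpow a)).1 (integrable_gaussian_power sqrt_t_gt0 a).
by apply: eq_integrable => // w _; rewrite /= mulr1.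
Qed.

Let marginal_moment i a : i \in D ->
  \int[P]_w (xi i w ^+ a) = gaussian_moment (Num.sqrt t) a.
Proof.
move=> iD; have mxi : measurable_fun setT (xi i) by [].
rewrite /gaussian_moment /Rintegral; congr fine.
rewrite (@integral_density _ _ _ _ R P (normal_prob 0 (Num.sqrt t)) (xi i)
  (cst 1) mxi (measurable_cst _) (fun=> ler01)
  (fun A => brownian_marginal iD) _ (mpow a) (integrable_gaussian_power sqrt_t_gt0 a)).
by apply: eq_integral => w _; rewrite mulr1.
Qed.

Let marginals_independent (J : {set I}) (A : I -> set R) : J \subset D ->
  (forall i, measurable (A i)) ->
  P (\bigcap_(i in [set` J]) (xi i @^-1` A i)) = (\prod_(i in J) P (xi i @^-1` A i))%E.
Proof.
move=> JD mA; apply: BM.2 => // i iJ.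
apply: sub_sigma_algebra; exists t; first exact: ltW.
by exists (A i); rewrite ?setTI.
Qed.

(* Indices outside D never occur in the matrix; the value 0 there makes all
   variables independent, with variance 0. *)
Let x (v : 'I_#|{: I}|) (w : T) : R :=
  if enum_val v \in D then xi (enum_val v) w else 0.

Let mom (v : 'I_#|{: I}|) k : R :=
  if enum_val v \in D then gaussian_moment (Num.sqrt t) k else (k == 0)%:R.

Let var (v : 'I_#|{: I}|) : R := if enum_val v \in D then t else 0.

Let mom_rec v k : mom v k.+1 = var v * (k%:R * mom v k.-1).
Proof.
rewrite /mom /var; case: ifP => _; last by rewrite mul0r.
by rewrite gaussian_momentS// sqr_sqrtr// ltW.
Qed.

Let prod_enum (F : 'I_#|{: I}| -> R) :
  \prod_v F v = (\prod_(i in D) F (enum_rank i)) * \prod_(i | i \notin D) F (enum_rank i).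
Proof.
rewrite (reindex enum_rank) /=; last first.
  by apply: onW_bij; apply: enum_rank_bij.
by rewrite (bigID (fun i => i \in D)).
Qed.

Let monomialE (m : 'I_#|{: I}| -> nat) w : \prod_v x v w ^+ m v =
  (\prod_(i in D) xi i w ^+ m (enum_rank i)) *
  \prod_(i | i \notin D) (m (enum_rank i) == 0)%:R.
Proof.
rewrite prod_enum; congr (_ * _); apply: eq_bigr => i iD; rewrite /x enum_rankK.
  by rewrite iD.
by rewrite (negPf iD) expr0n.
Qed.

Let monomial_product (m : 'I_#|{: I}| -> nat) :
  P.-integrable setT (fun w => (\prod_(i in D) xi i w ^+ m (enum_rank i))%:E) /\
  \int[P]_w (\prod_(i in D) xi i w ^+ m (enum_rank i)) =
  \prod_(i in D) \int[P]_w xi i w ^+ m (enum_rank i).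
Proof.
apply: (@expectation_prod _ _ _ P _ D xi marginals_independent D
  (fun i y => y ^+ m (enum_rank i))) => // i iD.
exact: integrable_marginal_power.
Qed.

Let monomial_integrable (m : 'I_#|{: I}| -> nat) :
  P.-integrable setT (fun w => (\prod_v x v w ^+ m v)%:E).
Proof.
have := integrableZr measurableT (\prod_(i | i \notin D) (m (enum_rank i) == 0)%:R)
  (monomial_product m).1.
by apply: eq_integrable => // w _; rewrite monomialE EFinM.
Qed.

Let monomial_expectation (m : 'I_#|{: I}| -> nat) :
  \int[P]_w (\prod_v x v w ^+ m v) = \prod_v mom v (m v).
Proof.
under eq_Rintegral do rewrite monomialE.
rewrite RintegralZr//; last exact: (monomial_product m).1.
rewrite (monomial_product m).2 prod_enum; congr (_ * _); apply: eq_bigr => i iD.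
  by rewrite marginal_moment// /mom enum_rankK iD.
by rewrite /mom enum_rankK (negPf iD).
Qed.

Let H := hermitian_poly_mx R n.
Let E (p : K) : R[i] := poly_expectation P x p.

Let Eadd : {additive K -> R[i]} := HB.pack E
  (GRing.isZmodMorphism.Build _ _ E
    (poly_expectation_is_zmod_morphism monomial_integrable)).

Let entry_coef_notin a b i : i \notin D -> entry_coef R a b i = 0.
Proof.
case: i => e [j l]; rewrite inE /entry_coef /=.
have [_|ab] := eqVneq a b.
  by case: e => //=; rewrite xpair_eqE -ltnNge => lj; case: eqP => // ja;
    case: eqP => // la; move: lj; rewrite ja la ltnn.
case: (ltngtP a b) => [altb|blta|/val_inj h]; last by rewrite h eqxx in ab.
- rewrite xpair_eqE; case: eqP => [->|_]; last by rewrite mul0r.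
  case: eqP => [->|_]; last by rewrite mul0r.
  by case: e; rewrite ?altb ?(ltnW altb).
- rewrite xpair_eqE; case: eqP => [->|_]; last by rewrite mul0r.
  case: eqP => [->|_]; last by rewrite mul0r.
  by case: e; rewrite ?blta ?(ltnW blta).
Qed.

Let E_parts a b p : Eadd (H a b * p) = t%:C * Eadd (entry_deriv a b p).
Proof.
rewrite /H mxE mulr_suml /entry_deriv !raddf_sum mulr_sumr; apply: eq_bigr => i _.
rewrite /= /E -scalerAl !(poly_expectationZ monomial_integrable).
rewrite (poly_expectation_parts monomial_integrable monomial_expectation mom_rec).
rewrite /var enum_rankK; case: ifPn => [_|iD]; first by rewrite mulrCA.
by rewrite entry_coef_notin// !mul0r mulr0.
Qed.

Let hermitian_loop k ks : Eadd (trace_prod H (k.+1 :: ks)) =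
  t%:C * (\sum_(r < k) Eadd (trace_prod H [:: val r, (k.-1 - r)%N & ks])
     + \sum_(p <- merges k ks) p.1%:R * Eadd (trace_prod H p.2)).
Proof.
exact: (loop_equation (D := fun a b => entry_deriv a b) (@entry_derivM R n)
  (@entry_deriv_entry R n) E_parts).
Qed.

Let hermitian_poly_mxE w a b :
  poly_value x w (H a b) = hermitian_bm B beta t w a b.
Proof.
have -> : poly_value x w (H a b) =
    \sum_(i : I) entry_coef R a b i * (x (enum_rank i) w)%:C.
  rewrite /H mxE /poly_value raddf_sum; apply: eq_bigr => i _.
  by rewrite /= mevalZ mevalXU.
rewrite mxE.
have xE i : i \in D -> x (enum_rank i) w = xi i w by move=> iD; rewrite /x enum_rankK iD.
have [<-|ab] := eqVneq a b.
  under eq_bigr => i _.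
    rewrite /entry_coef eqxx -mulnb natrM [_%:R * _%:R]mulrC.
    over.
  rewrite (sum_at_pair (fun e => (~~ e)%:R) (fun i => (x (enum_rank i) w)%:C)) /=.
  by rewrite mul0r add0r mul1r xE// inE /=.
have aux (c e : R) (f : R) : 'i * c%:C * e%:C + c%:C * f%:C = c%:C * (f +i* e).
  by apply/eqP; rewrite eq_complex /=; apply/andP; split; apply/eqP; ring.
case: (ltngtP a b) => [altb|blta|/val_inj h]; last by rewrite h eqxx in ab.
- under eq_bigr => i _ do rewrite /entry_coef (negPf ab) altb.
  rewrite (sum_at_pair (fun e => if e then 'i * _ else _) (fun i => (x (enum_rank i) w)%:C)) /=.
  by rewrite !xE ?inE/= ?altb ?(ltnW altb)// aux.
- under eq_bigr => i _ do rewrite /entry_coef (negPf ab) ltnNge (ltnW blta) /=.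
  rewrite (sum_at_pair (fun e => if e then - ('i * _) else _) (fun i => (x (enum_rank i) w)%:C)) /=.
  rewrite !xE ?inE/= ?blta ?(ltnW blta)//.
  by apply/eqP; rewrite eq_complex /=; apply/andP; split; apply/eqP; ring.
Qed.

Let hermitian_bm_adjoint w a b :
  hermitian_bm B beta t w a b = (hermitian_bm B beta t w b a)^*%R.
Proof.
rewrite !mxE eq_sym; have [<-|ab] := eqVneq b a.
  by apply/eqP; rewrite eq_complex /= oppr0 !eqxx.
case: (ltngtP a b) => [//|//|/val_inj h]; last by rewrite h eqxx in ab.
by rewrite -[RHS]/(conjc (conjc _)) conjcK.
Qed.

Variable X : 'I_n -> T -> R.
Hypothesis X_eigenvalues : forall w,
  ordered_eigenvalues (hermitian_bm B beta t w) (fun j => X j w).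

(** Evaluating the polynomial matrix at the driving variables gives the Hermitian
    Brownian motion, whose trace powers are the power sums of its eigenvalues. *)
Let value_power_trace w k :
  poly_value x w (power_trace H k) = (\sum_(j < n) X j w ^+ k)%:C.
Proof.
have Hw : map_mx (poly_value x w) H = hermitian_bm B beta t w.
  by apply/matrixP => a b; rewrite mxE hermitian_poly_mxE.
have valM p q : poly_value x w (p * q) = poly_value x w p * poly_value x w q.
  exact: mevalM.
have val_sum (J : finType) (F : J -> K) :
    poly_value x w (\sum_j F j) = \sum_j poly_value x w (F j).
  exact: (raddf_sum (meval _)).
have HwX : map_mx (poly_value x w) (H ^+ k) = hermitian_bm B beta t w ^+ k.
  elim: k => [|k IH].
    rewrite !expr0; apply/matrixP => a b; rewrite !mxE.
    by case: (a == b); rewrite ?mulr1n ?mulr0n /poly_value ?meval1 ?meval0.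
  rewrite !exprS -IH -[in RHS]Hw; apply/matrixP => a b; rewrite !mxE val_sum.
  by apply: eq_bigr => c _; rewrite valM !mxE.
rewrite rmorph_sum /=.
under eq_bigr do rewrite rmorphXn.
rewrite -(mxtrace_power_eigenvalues k (hermitian_bm_adjoint w) (X_eigenvalues w).2).
rewrite -HwX /power_trace /mxtrace val_sum.
by apply: eq_bigr => a _; rewrite mxE.
Qed.

Lemma integrable_power_sum k :
  P.-integrable setT (EFin \o (fun w => \sum_(j < n) X j w ^+ k)).
Proof.
have := (integrable_poly_value monomial_integrable (power_trace H k)).1.
by apply: eq_integrable => // w _; rewrite /= value_power_trace.
Qed.

(** Dividing each trace by [n] turns the covariance [1 / n] into a factor 1 for
    the terms in which a trace splits, and a factor [n ^ -2] for those in which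
    two traces merge. *)
Lemma power_sum_moment_system : (0 < n)%N -> t = n%:R^-1 ->
  exists G : seq nat -> R, [/\ G [::] = 1,
    forall ks, G (0%N :: ks) = G ks,
    forall k ks, G (k.+1 :: ks) =
      \sum_(r < k) G [:: val r, (k.-1 - r)%N & ks]
      + n%:R ^- 2 * \sum_(p <- merges k ks) p.1%:R * G p.2 &
    forall k, G [:: k] = n%:R^-1 * \int[P]_w (\sum_(j < n) X j w ^+ k)].
Proof.
move=> n0 tE; have nR : n%:R != 0 :> R by rewrite pnatr_eq0 -lt0n.
exists (fun ks => n%:R^-1 ^+ size ks * complex.Re (Eadd (trace_prod H ks))).
have E1 : Eadd 1 = 1.
  rewrite /= /E -mpolyX0 (poly_expectationX monomial_expectation) big1//.
  move=> v _; rewrite mnm0E /mom gaussian_moment0//.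
  by case: ifP.
have ReD (a b : R[i]) : complex.Re (a + b) = complex.Re a + complex.Re b.
  by case: a b => [? ?] [].
have ReN (m : nat) (z : R[i]) : complex.Re (m%:R * z) = m%:R * complex.Re z.
  by rewrite !mulr_natl; elim: m => [//|m IH]; rewrite !mulrSr ReD IH.
have ReMn (m : nat) (z : R[i]) : complex.Re (z *+ m) = complex.Re z *+ m.
  by rewrite -mulr_natl ReN mulr_natl.
have Re_sum (J : Type) (s : seq J) (F : J -> R[i]) :
    complex.Re (\sum_(j <- s) F j) = \sum_(j <- s) complex.Re (F j).
  exact: (big_morph _ ReD (erefl _)).
have ReC (c : R) (z : R[i]) : complex.Re (c%:C * z) = c * complex.Re z.
  by case: z => a b /=; rewrite mul0r subr0.
split.
- by rewrite /trace_prod big_nil E1 /= mul1r.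
- move=> ks; rewrite /trace_prod big_cons -/(trace_prod H ks) /power_trace expr0.
  have -> : \tr (1 : 'M[K]_n) = n%:R by rewrite mxtrace1.
  rewrite mulr_natl (raddfMn Eadd) ReMn [size _]/= exprS -(mulr_natl (complex.Re _) n).
  by rewrite mulrACA mulVf// mul1r.
- move=> k ks; rewrite hermitian_loop ReC tE [size (_ :: _)]/= mulrA -exprSr.
  rewrite ReD mulrDr !Re_sum !mulr_sumr; congr (_ + _).
  rewrite big_seq [RHS]big_seq; apply: eq_bigr => p hp.
  have [_ ->] := sumn_merges hp.
  rewrite ReN 2!exprS (_ : n%:R ^- 2 = n%:R^-1 * n%:R^-1); last by rewrite -expr2 exprVn.
  by move: (n%:R^-1) (_ ^+ _) (complex.Re _) => u v z; ring.
- move=> k; rewrite /= expr1 /trace_prod big_seq1; congr (_ * _).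
  rewrite /E /poly_expectation /=; apply: eq_Rintegral => w _.
  by rewrite value_power_trace.
Qed.

End HermitianBrownianMoments.

(** * Averages over the eigenvalues *)

Section EmpiricalMeans.
Context d (T : measurableType d) (R : realType) (P : probability T R) (n : nat).
Variable x : 'I_n -> T -> R.
Hypothesis mx : forall j, measurable_fun setT (x j).

Definition mean_value (g : R -> R) : R :=
  n%:R^-1 * \int[P]_w (\sum_(j < n) g (x j w)).

Section BoundedFunction.
Variables (f : R -> R) (b : R).
Hypotheses (cf : continuous f) (fb : forall y, `|f y| <= b).

Let mf : measurable_fun setT f.
Proof. exact: continuous_measurable_fun. Qed.

Let integrable_eigen j : P.-integrable setT (fun w => (f (x j w))%:E).
Proof.
apply: (@measurable_bounded_integrable _ _ _ P (fun w => f (x j w))) => //.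
- by apply: (le_lt_trans (@probability_le1 _ _ _ P _ measurableT)); exact: ltry.
- exact: (measurableT_comp mf (mx j)).
- exists b; split; first exact: num_real.
  by move=> M bM w _ /=; exact: le_trans (fb _) (ltW bM).
Qed.

Let sum_integral : (\sum_(j < n) \int[P]_w (f (x j w))%:E)%E =
  (\int[P]_w (\sum_(j < n) f (x j w)))%:E.
Proof.
have E : (\int[P]_w (\sum_(j < n) f (x j w))%:E)%E =
    (\sum_(j < n) \int[P]_w (f (x j w))%:E)%E.
  rewrite -integral_sum//.
  by apply: eq_integral => w _; rewrite sumEFin.
rewrite /Rintegral E fineK// sum_fin_num; apply/allP => y /mapP[j _ ->].
exact: integrable_fin_num.
Qed.

Lemma mean_expectation :
  ((n%:R^-1)%:E * \sum_(j < n) 'E_P[fun w => f (x j w)] = (mean_value f)%:E)%E.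
Proof.
by rewrite /mean_value expectation.unlock sum_integral.
Qed.

Lemma integrable_bounded_sum :
  P.-integrable setT (EFin \o (fun w => \sum_(j < n) f (x j w))).
Proof.
have := integrable_sum measurableT (index_enum 'I_n) (P := xpredT)
  (fun j _ => integrable_eigen j).
by apply: eq_integrable => // w _; rewrite /= sumEFin.
Qed.

Lemma expectation_mean :
  ('E_P[fun w => (n%:R^-1 * \sum_(j < n) f (x j w))%R] = (mean_value f)%:E)%E.
Proof.
rewrite expectation.unlock /mean_value -RintegralZl//; last exact: integrable_bounded_sum.
rewrite fineK//; apply: integrable_fin_num => //.
have := integrableZl measurableT n%:R^-1 integrable_bounded_sum.
by apply: eq_integrable.
Qed.

End BoundedFunction.

Hypothesis integrable_powers : forall k,
  P.-integrable setT (EFin \o (fun w => \sum_(j < n) x j w ^+ k)).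

Let poly_sumE (q : {poly R}) w :
  \sum_(j < n) q.[x j w] = \sum_(i < size q) q`_i * \sum_(j < n) x j w ^+ i.
Proof.
under eq_bigr do rewrite horner_coef.
by rewrite exchange_big; apply: eq_bigr => i _; rewrite mulr_sumr.
Qed.

Let integrable_scaled_power c k : P.-integrable setT
  (EFin \o (fun w => c * \sum_(j < n) x j w ^+ k)).
Proof.
by have := integrableZl measurableT c (integrable_powers k); apply: eq_integrable.
Qed.

Lemma integrable_poly_sum (q : {poly R}) :
  P.-integrable setT (EFin \o (fun w => \sum_(j < n) q.[x j w])).
Proof.
have := integrable_sum measurableT (index_enum 'I_(size q)) (P := xpredT)
  (fun (i : 'I_(size q)) _ => integrable_scaled_power q`_i i).
by apply: eq_integrable => // w _; rewrite /= sumEFin poly_sumE.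
Qed.

Lemma mean_poly (q : {poly R}) : mean_value (horner q) =
  \sum_(i < size q) q`_i * mean_value (fun y => y ^+ i).
Proof.
rewrite /mean_value; under eq_Rintegral do rewrite poly_sumE.
have -> : \int[P]_w (\sum_(i < size q) q`_i * \sum_(j < n) x j w ^+ i) =
    \sum_(i < size q) q`_i * \int[P]_w (\sum_(j < n) x j w ^+ i).
  rewrite /Rintegral; under eq_integral do rewrite -sumEFin.
  rewrite (integral_sum measurableT (fun i : 'I_(size q) => integrable_scaled_power q`_i i)).
  rewrite -sum_fine => [|i _]; last exact: integrable_fin_num (integrable_scaled_power _ _).
  by apply: eq_bigr => i _; rewrite -[LHS]/(Rintegral _ _ _) RintegralZl.
by rewrite mulr_sumr; apply: eq_bigr => i _; rewrite mulrCA.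
Qed.

Lemma le_mean_value (g h : R -> R) :
  P.-integrable setT (EFin \o (fun w => \sum_(j < n) g (x j w))) ->
  P.-integrable setT (EFin \o (fun w => \sum_(j < n) h (x j w))) ->
  (forall y, g y <= h y) -> mean_value g <= mean_value h.
Proof.
move=> gi hi gh; rewrite /mean_value ler_wpM2l// ?invr_ge0//.
by apply: le_Rintegral => // w _; apply: ler_sum.
Qed.

End EmpiricalMeans.

Section EmpiricalIntegral.
Variables (R : realType) (n : nat) (y : 'I_n -> R).

Let ge0_integral_empirical (f : R -> \bar R) : measurable_fun setT f ->
  (forall z, 0 <= f z)%E ->
  (\int[empirical_measure y]_z f z = (n%:R^-1)%:E * \sum_(j < n) f (y j))%E.
Proof.
move=> mf f0.
have n0 : (0 <= n%:R^-1 :> R)%R by rewrite invr_ge0.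
pose m (k : nat) : {measure set R -> \bar R} :=
  if insub k is Some j then \d_(y j) else mzero.
rewrite (@eq_measure_integral _ _ _ _ (mscale (NngNum n0) (msum m n))); last first.
  move=> A _ _; rewrite /= /empirical_measure /mscale /msum /=.
  by congr (_ * _)%E; apply: eq_bigr => j _; rewrite /m valK.
rewrite ge0_integral_mscale// ge0_integral_measure_sum//; congr (_ * _)%E.
apply: eq_bigr => j _; rewrite /m valK integral_dirac//.
by rewrite diracT mul1e.
Qed.

Lemma Rintegral_empirical (f : R -> R) : continuous f ->
  \int[empirical_measure y]_z f z = n%:R^-1 * \sum_(j < n) f (y j).
Proof.
move=> cf; have mf : measurable_fun setT f by exact: continuous_measurable_fun.
have mEf : measurable_fun setT (EFin \o f) by exact/measurable_EFinP.
rewrite /Rintegral integralE.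
rewrite !ge0_integral_empirical//; last 2 first.
- exact: measurable_funeneg.
- exact: measurable_funepos.
have posE z : ((EFin \o f)^\+ z = (Num.max (f z) 0)%:E)%E by rewrite funeposE -EFin_max.
have negE z : ((EFin \o f)^\- z = (Num.max (- f z) 0)%:E)%E.
  by rewrite funenegE -EFinN -EFin_max.
under eq_bigr do rewrite posE.
under [in X in (_ - X)%E]eq_bigr do rewrite negE.
rewrite !sumEFin /= -mulrBr -sumrB; congr (_ * _); apply: eq_bigr => j _.
case/orP: (le_total 0 (f (y j))) => f0.
  by rewrite max_l// max_r ?subr0// oppr_le0.
by rewrite max_r// max_l ?sub0r ?opprK// oppr_ge0.
Qed.

End EmpiricalIntegral.

(** * Dyson Brownian motion at time 1 / n *)

Section DysonMoments.
Context d (T : measurableType d) (R : realType) (P : probability T R) (n : nat).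
Variable X : 'I_n -> R -> T -> R.
Hypotheses (n_gt0 : (0 < n)%N) (hX : dyson_brownian_motion P X).

Let x j := X j n%:R^-1.

Let t_gt0 : 0 < n%:R^-1 :> R. Proof. by rewrite invr_gt0 ltr0n. Qed.

Lemma dyson_integrable_power_sum k :
  P.-integrable setT (EFin \o (fun w => \sum_(j < n) x j w ^+ k)).
Proof.
have [B [beta [BM ev]]] := hX.
by apply: (integrable_power_sum t_gt0 BM) => w; apply: ev; exact: ltW.
Qed.

Lemma dyson_measurable j : measurable_fun setT (x j).
Proof.
apply: measurable_sorted => [w i l il|k].
  by have [B [beta [BM ev]]] := hX; have [+ _] := ev n%:R^-1 w (ltW t_gt0); apply.
by case/integrableP : (dyson_integrable_power_sum k) => /measurable_EFinP.
Qed.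

Lemma dyson_moment_system : exists G : seq nat -> R, [/\ G [::] = 1,
  forall ks, G (0%N :: ks) = G ks,
  forall k ks, G (k.+1 :: ks) =
    \sum_(r < k) G [:: val r, (k.-1 - r)%N & ks]
    + n%:R ^- 2 * \sum_(p <- merges k ks) p.1%:R * G p.2 &
  forall k, G [:: k] = mean_value P x (fun y => y ^+ k)].
Proof.
have [B [beta [BM ev]]] := hX.
by apply: (power_sum_moment_system t_gt0 BM) => // w; apply: ev; exact: ltW.
Qed.

End DysonMoments.

Theorem proposition5p14 (R : realType) (d : nat -> measure_display)
    (T : forall n : nat, measurableType (d n))
    (P : forall n : nat, probability (T n) R)
    (X : forall n : nat, 'I_n -> R -> T n -> R)
    (hX : forall n : nat, dyson_brownian_motion (P n) (X n))
    (f : R -> R) (hfc : continuous f) (hfb : bounded_fun f) :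
  let L : \bar R :=
    (\int[lebesgue_measure]_(x in `[(-2)%R, 2%R])
        (f x * semicircle_density x)%:E)%E in
  ((fun n : nat =>
      'E_(P n)[fun w : T n =>
        (\int[empirical_measure (fun j : 'I_n => X n j (n%:R^-1)%R w)]_x f x)%R])%E
     @ \oo --> L)
  /\
  ((fun n : nat =>
      ((n%:R^-1)%:E *
        \sum_(j < n) 'E_(P n)[fun w : T n => f (X n j (n%:R^-1)%R w)])%E)
     @ \oo --> L).
Proof.
move=> L.
have [b fb] : exists b, forall y, `|f y| <= b.
  have [b [_ hb]] := hfb; exists (b + 1) => y; by apply: hb => //; rewrite ltrDl ltr01.
pose x n j := X n j n%:R^-1.
have mx n j : measurable_fun setT (x n.+1 j) by exact: dyson_measurable (hX n.+1) j.
have ipow n k := dyson_integrable_power_sum (ltn0Sn n) (hX n.+1) k.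
have fsum n := integrable_bounded_sum (P n.+1) (mx n) hfc fb.
pose u n := mean_value (P n.+1) (x n.+1) f.
have cu : u @ \oo --> semicircle_integral f.
  have /choice[G hG] := fun n => dyson_moment_system (ltn0Sn n) (hX n.+1).
  apply: (@moment_method R (fun n k => G n [:: k]) u f b) => // [k|n q qf|n q fq].
  - have := @cvg_loop R (@semicircle_moment R) G (@semicircle_moment0 R)
      (@semicircle_moment_catalan R) _ _ _ [:: k].
    rewrite big_seq1; apply => n.
    + by have [-> _ _ _] := hG n.
    + by move=> ks; have [_ -> _ _] := hG n.
    + by move=> m ks; have [_ _ -> _] := hG n.
  - under eq_bigr => i _ do have [_ _ _ ->] := hG n.
    rewrite -(mean_poly (ipow n)); apply: le_mean_value => //.
    exact: integrable_poly_sum (ipow n) q.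
  - under eq_bigr => i _ do have [_ _ _ ->] := hG n.
    rewrite -(mean_poly (ipow n)); apply: le_mean_value => //.
    exact: integrable_poly_sum (ipow n) q.
have LE : L = (semicircle_integral f)%:E.
  rewrite /semicircle_integral /Rintegral fineK//; apply: integrable_fin_num => //.
  exact: integrable_mul_semicircle.
have cE : (fun n => (u n)%:E) @ \oo --> L.
  by rewrite LE; apply/fine_cvgP; split; [exact: nearW|exact: cu].
(* The time 1 / n is positive only for n > 0: limits are taken along n + 1. *)
split; rewrite -cvg_shiftS /=.
- apply: cvg_trans cE; apply: near_eq_cvg; apply: nearW => n.
  rewrite -(expectation_mean (P n.+1) (mx n) hfc fb); congr ('E_(P n.+1)[_])%E.
  by apply/funext => w; rewrite Rintegral_empirical.
- apply: cvg_trans cE; apply: near_eq_cvg; apply: nearW => n.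
  by rewrite -(mean_expectation (P n.+1) (mx n) hfc fb).
Qed.
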